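(* A graph $T$ is a minimal forbidden induced subgraph for the class of theta-ring graphs if and only if $T$ satisfies at least one of the following conditions: (a) $T$ is a $\theta$-partial wheel. (b) $T$ is a prism, a pyramid or a theta.
   Context: All graphs are finite and simple. A chorded-theta of $G$ is an induced subgraph $T$ of $G$ together with three paths $\mathcal{L}_1,\mathcal{L}_2,\mathcal{L}_3$ of $G$, each between two given non-adjacent vertices $x$ and $y$, such that $V(\mathcal{L}_i)\cap V(\mathcal{L}_j)=\{x,y\}$ for $1\le i<j\le 3$ and $T$ is the subgraph induced by $V(\mathcal{L}_1)\cup V(\mathcal{L}_2)\cup V(\mathcal{L}_3)$. A transversal triangle of $T$ is a triangle in $G$ having exactly one vertex in the interior $V(\mathcal{L}_i)\setminus\{x,y\}$ of each path $\mathcal{L}_i$, $i=1,2,3$. $G$ is a theta-ring graph if every chorded-theta of $G$ has a transversal triangle. A minimal forbidden induced subgraph for the class of theta-ring graphs is a graph that is not a theta-ring graph but all of whose proper induced subgraphs are theta-ring graphs. A partial wheel $W$ has vertex set $\{z,z_1,\dots,z_k\}$, where $C=(z_1,\dots,z_k,z_1)$ is a cycle (the rim), and its edges are the edges of $C$ and some edges between $z$ (the center) and vertices of $C$. A partial wheel $W$ with rim $C$ and center $z$ is a $\theta$-partial wheel if $|V(C)|\ge4$ and there exist two non-adjacent vertices in $V(C)\cap N_W(z)$. A prism consists of two vertex-disjoint triangles $(x_1,x_2,x_3,x_1)$ and $(y_1,y_2,y_3,y_1)$ and three pairwise vertex-disjoint paths $L_1,L_2,L_3$, with $L_i$ between $x_i$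 and $y_i$, such that the subgraph induced by $V(L_i)\cup V(L_j)$ is a cycle for $1\le i<j\le3$. A pyramid consists of a vertex $w$, a triangle $(z_1,z_2,z_3,z_1)$ and three paths $P_1,P_2,P_3$, with $P_i$ between $w$ and $z_i$, such that $V(P_i)\cap V(P_j)=\{w\}$ and the subgraph induced by $V(P_i)\cup V(P_j)$ is a cycle for $1\le i<j\le3$, and at most one of $P_1,P_2,P_3$ has only one edge. A theta consists of two non-adjacent vertices $x,y$ and three paths $P,Q,R$ with ends $x$ and $y$ such that the union of every two of $P,Q,R$ is an induced cycle. *)

(* Defs.v *)
From mathcomp Require Import all_boot.

Set Implicit Arguments.
Unset Strict Implicit.
Unset Printing Implicit Defensive.

Record sgraph := SGraph {
  svertex :> finType;
  sedge : rel svertex;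
  sedge_sym : symmetric sedge;
  sedge_irr : irreflexive sedge }.

Notation "x -- y" := (sedge x y) (at level 30).

Section Induced.
Variables (G : sgraph) (S : {set G}).

Definition induced_edge : rel {x : G | x \in S} := fun u v => val u -- val v.

Lemma induced_edge_sym : symmetric induced_edge.
Proof. by move=> u v; exact: sedge_sym. Qed.

Lemma induced_edge_irr : irreflexive induced_edge.
Proof. by move=> u; exact: sedge_irr. Qed.

Definition induced : sgraph := SGraph induced_edge_sym induced_edge_irr.
End Induced.

Definition minimal_forbidden (P : sgraph -> Prop) (G : sgraph) : Prop :=
  ~ P G /\ forall S : {set G}, S != setT -> P (induced S).

Section Notions.
Variable G : sgraph.
Implicit Types (x y u v w z : G) (p q c : seq G) (S : {set G}).

(* A path is the list of all its vertices, both ends included; it need not be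
   an induced path. *)
Definition path_between x y p : bool :=
  [&& ohead p == Some x, last x p == y, uniq p & sorted (@sedge G) p].

Definition path_vertices p : {set G} := [set v in p].

Definition path_interior x y p : {set G} := path_vertices p :\: [set x; y].

Definition path_length p : nat := (size p).-1.

Definition path_edge p : rel G := fun u v =>
  ((u, v) \in zip p (behead p)) || ((v, u) \in zip p (behead p)).

(* c lists, in cyclic order, the vertices of an induced cycle (triangles are
   allowed). *)
Definition induced_cycle c : Prop :=
  [/\ 2 < size c, uniq c &
      {in c &, forall u v, u -- v = (next c u == v) || (next c v == u)}].

Definition induces_cycle S : Prop :=
  exists2 c, induced_cycle c & S = path_vertices c.

Definition triangle (t : 'I_3 -> G) : Prop :=
  forall i j : 'I_3, i != j -> t i -- t j.

Definition triangle_vertices (t : 'I_3 -> G) : {set G} :=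
  [set t i | i : 'I_3].

(* The subgraph meant is the one induced by the union of the three paths, so
   it is determined by x, y and L. *)
Definition chorded_theta x y (L : 'I_3 -> seq G) : Prop :=
  [/\ x != y, ~~ (x -- y),
      forall i : 'I_3, path_between x y (L i) &
      forall i j : 'I_3, i < j ->
        path_vertices (L i) :&: path_vertices (L j) = [set x; y]].

Definition transversal_triangle x y (L : 'I_3 -> seq G) (t : 'I_3 -> G)
    : Prop :=
  triangle t /\
  forall i : 'I_3, #|triangle_vertices t :&: path_interior x y (L i)| = 1.

Definition theta_ring : Prop :=
  forall x y (L : 'I_3 -> seq G), chorded_theta x y L ->
    exists t : 'I_3 -> G, transversal_triangle x y L t.

(* Center z and rim c; being an induced cycle, c leaves only edges at z free. *)
Definition partial_wheel z c : Prop :=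
  [/\ induced_cycle c, z \notin c & forall v, v \in z :: c].

Definition theta_partial_wheel : Prop :=
  exists z c,
    [/\ partial_wheel z c, 4 <= size c &
        exists u v, [/\ u \in c, v \in c, z -- u, z -- v & (u != v) && ~~ (u -- v)]].

(* In the next three definitions the paths cover all vertices, and any two
   vertices lie in the union of two of the paths, so the conditions on these
   unions determine all edges. *)
Definition prism : Prop :=
  exists (x y : 'I_3 -> G) (L : 'I_3 -> seq G),
    [/\ [/\ triangle x, triangle y &
            [disjoint triangle_vertices x & triangle_vertices y]],
        forall i : 'I_3, path_between (x i) (y i) (L i),
        forall i j : 'I_3, i < j ->
          [disjoint path_vertices (L i) & path_vertices (L j)],
        forall i j : 'I_3, i < j ->
          induces_cycle (path_vertices (L i) :|: path_vertices (L j)) &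
        forall v, exists i : 'I_3, v \in L i].

Definition pyramid : Prop :=
  exists w (z : 'I_3 -> G) (P : 'I_3 -> seq G),
    [/\ triangle z,
        forall i : 'I_3, path_between w (z i) (P i),
        forall i j : 'I_3, i < j ->
          path_vertices (P i) :&: path_vertices (P j) = [set w] /\
          induces_cycle (path_vertices (P i) :|: path_vertices (P j)),
        #|[set i : 'I_3 | path_length (P i) == 1]| <= 1 &
        forall v, exists i : 'I_3, v \in P i].

(* The union of two paths is an induced cycle: their vertices induce a cycle,
   all of whose edges are edges of the paths. *)
Definition union_induced_cycle p q : Prop :=
  let S := path_vertices p :|: path_vertices q in
  induces_cycle S /\
  {in S &, forall u v, u -- v = path_edge p u v || path_edge q u v}.

Definition theta : Prop :=
  exists x y (P : 'I_3 -> seq G),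
    [/\ x != y, ~~ (x -- y),
        forall i : 'I_3, path_between x y (P i),
        forall i j : 'I_3, i < j -> union_induced_cycle (P i) (P j) &
        forall v, exists i : 'I_3, v \in P i].

End Notions.

(* Main.v *)
Require Import Defs.
From mathcomp Require Import all_boot zify.
From Stdlib Require Import Classical.

(* A graph is minimal forbidden iff it has a chorded theta without transversal
   triangle and every such chorded theta uses all its vertices.

   Each configuration carries such a chorded theta, and a chorded theta inside
   it cannot miss a vertex: its ends have degree at least three, and
   once a vertex is removed they are separated by at most two edges (for a
   wheel, by one rim edge and edges at the center), whereas three internally
   disjoint paths between non-adjacent vertices need three edges.

   For the existence of a configuration, let C be the component of y in the
   graph without the neighbours of x. Each of the three paths passes through a
   neighbour of x that has a neighbour in C. If there is no transversal
   triangle, two of these vertices, a and b, are not adjacent; so x, a, b and a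
   shortest path through C form an induced cycle R of length at least four. The
   third vertex c yields a path outside R joining two non-adjacent vertices of
   R. If p is a shortest such path, then any two vertices of R that are attached
   to p are equal or adjacent, unless they are attached to its two different
   ends. Hence either a vertex of R is the center of a wheel whose rim is the
   rest of R closed by p, or each end of p is attached to one vertex or to one
   edge of R, and R with p is a theta, a pyramid or a prism. *)

Set Implicit Arguments.
Unset Strict Implicit.
Unset Printing Implicit Defensive.

(** * Transversal triangles in chorded thetas *)

Section Basics.
Variable G : sgraph.
Implicit Types (x y u v w z : G) (p q c s : seq G) (L : 'I_3 -> seq G).

Lemma sedgeC u v : u -- v = v -- u.
Proof. exact: sedge_sym. Qed.

Lemma sedge_neq u v : u -- v -> u != v.
Proof. by move=> uv; apply/eqP=> E; rewrite E sedge_irr in uv. Qed.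

(** Labelling each vertex of the triangle by the path containing it replaces cardinalities by
    memberships, which transfer more easily between graphs. *)
Definition disjoint_transversal x y L : Prop :=
  exists2 t : 'I_3 -> G, triangle t & forall i, t i \in path_interior x y (L i).

Definition bad_theta x y L : Prop :=
  chorded_theta x y L /\ ~ disjoint_transversal x y L.

Lemma in_interior x y p v :
  (v \in path_interior x y p) = [&& v != x, v != y & v \in p].
Proof. by rewrite !inE negb_or andbA. Qed.

Lemma chorded_theta_disj x y L i j v :
  chorded_theta x y L -> i != j -> v \in L i -> v \in L j -> v = x \/ v = y.
Proof.
case=> _ _ _ D neq vi vj.
have H : v \in path_vertices (L i) :&: path_vertices (L j) by rewrite !inE vi vj.
have : v \in [set x; y].
  case: (ltngtP i j) => [lt|gt|E]; [by rewrite -(D i j)| |].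
    by rewrite -(D j i) // setIC.
  by rewrite (val_inj E) eqxx in neq.
by rewrite !inE => /orP[]/eqP->; [left|right].
Qed.

(** The interiors of the paths are pairwise disjoint. So the vertices picked from the three
    interiors are distinct, hence pairwise adjacent; conversely, if [t j] is in the interior of path
    [i], then [j = i]. *)
Lemma transversalP x y L : chorded_theta x y L ->
  (exists t, transversal_triangle x y L t) <-> disjoint_transversal x y L.
Proof.
move=> ct.
have D i j v : v \in path_interior x y (L i) -> v \in path_interior x y (L j) -> i = j.
  rewrite !in_interior => /and3P[vx vy vi] /and3P[_ _ vj].
  apply/eqP; apply: contraT => neq.
  by case: (chorded_theta_disj ct neq vi vj) => E; rewrite E eqxx in vx vy.
split.
  case=> t [tt tc].
  have pk i : exists v, v \in triangle_vertices t :&: path_interior x y (L i).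
    by apply/card_gt0P; rewrite tc.
  pose t' i := xchoose (pk i).
  have t'P i : t' i \in triangle_vertices t :&: path_interior x y (L i).
    exact: (xchooseP (pk i)).
  exists t'; last by move=> i; have := t'P i; rewrite inE => /andP[].
  move=> i j ij; have := t'P i; have := t'P j; rewrite !(in_setI (t' _)).
  case/andP=> /imsetP[b _ eb] tj /andP[/imsetP[a _ ea] ti].
  rewrite ea eb; apply: tt; apply: contraNneq ij => ab.
  by apply/eqP/(D _ _ (t' i)) => //; rewrite ea ab -eb.
case=> t tt ti; exists t; split=> // i; apply/eqP/cards1P.
exists (t i); apply/setP=> v; rewrite in_setI; apply/andP/set1P => [[]|->].
  by case/imsetP=> j _ -> tj; rewrite (D _ _ _ (ti j) tj).
by split=> //; apply/imsetP; exists i.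
Qed.

End Basics.

(** * Chorded thetas of induced subgraphs *)

Section Restriction.
Variables (G : sgraph) (S : {set G}).
Implicit Types (x y : induced S) (L : 'I_3 -> seq (induced S)).

Lemma val_path_between x y (p : seq (induced S)) :
  path_between (val x) (val y) (map val p) = path_between x y p.
Proof.
rewrite /path_between (map_inj_uniq val_inj) last_map.
rewrite (inj_eq val_inj); congr [&& _, _, _ & _].
  by case: p => //= a p; apply/eqP/eqP => [[/val_inj->]|[->]].
by case: p => //= a p; rewrite path_map.
Qed.

Lemma val_vertices (p q : seq (induced S)) x y :
  (path_vertices (map val p) :&: path_vertices (map val q) = [set val x; val y]) <->
  (path_vertices p :&: path_vertices q = [set x; y]).
Proof.
have inj := val_inj : injective (fun u : induced S => val u).
split=> [/setP E|/setP E]; apply/setP=> u.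
  by have := E (val u); rewrite !inE !(mem_map inj) !(inj_eq inj).
rewrite !inE; case: (boolP (u \in S)) => uS.
  have -> : u = val (Sub u uS : induced S) by [].
  by have := E (Sub u uS); rewrite !inE !(mem_map inj) !(inj_eq inj).
have N (r : seq (induced S)) : u \in map val r = false.
  by apply/negbTE; apply: contra uS => /mapP[w _ ->]; exact: valP.
have M (w : induced S) : u == val w = false.
  by apply/negbTE; apply: contra uS => /eqP->; exact: valP.
by rewrite !N !M.
Qed.

Lemma val_chorded_theta x y L :
  chorded_theta (val x) (val y) (fun i => map val (L i)) <-> chorded_theta x y L.
Proof.
split=> -[xy nxy pb D]; split=> //.
- by move=> i; rewrite -val_path_between.
- by move=> i j /D/val_vertices.
- by move=> i; rewrite val_path_between.
- by move=> i j /D/val_vertices.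
Qed.

Lemma val_disjoint_transversal x y L :
  disjoint_transversal (val x) (val y) (fun i => map val (L i)) <->
  disjoint_transversal x y L.
Proof.
split; last first.
  case=> t tt ti; exists (fun i => val (t i)) => // i.
  by have := ti i; rewrite !in_interior (mem_map val_inj).
case=> t tt ti.
have E i : exists u : induced S, t i = val u /\ u \in L i.
  by have := ti i; rewrite in_interior => /and3P[_ _ /mapP[u uL ->]]; exists u.
have [t0 t0P] : exists t0 : 'I_3 -> induced S, forall i, t i = val (t0 i) /\ t0 i \in L i.
  have E' i : exists u : induced S, (t i == val u) && (u \in L i).
    by case: (E i) => u [-> uL]; exists u; rewrite eqxx.
  exists (fun i => xchoose (E' i)) => i.
  by have /andP[/eqP] := xchooseP (E' i).
exists t0 => [i j ij|i].
  by have := tt i j ij; rewrite (t0P i).1 (t0P j).1.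
have := ti i; rewrite !in_interior (t0P i).1 => /and3P[a b _].
by rewrite (t0P i).2 !andbT -!(inj_eq val_inj) a.
Qed.

End Restriction.

(** A bad theta missing [v] lives in the graph induced by the complement of [v], and a bad theta of
    a proper induced subgraph is one of [G] that misses a vertex. *)
Lemma minimal_forbiddenP (G : sgraph) :
  minimal_forbidden theta_ring G <->
  (exists (x y : G) L, bad_theta x y L) /\
  (forall (x y : G) L, bad_theta x y L -> forall v, exists i, v \in L i).
Proof.
have nring (H : sgraph) : ~ theta_ring H <-> exists (x y : H) L, bad_theta x y L.
  split=> [nr|[x [y [L [ct nt]]]] r]; last first.
    by case: (r _ _ _ ct) => t tP; apply: nt; apply/transversalP => //; exists t.
  apply: NNPP => ne; apply: nr => x y L ct; apply: NNPP => nt; apply: ne.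
  by exists x, y, L; split=> // /(transversalP ct).
split.
  case=> /nring ex mf; split=> // x y L [ct nt] v; apply: NNPP => nv.
  pose S := [set: G] :\ v.
  have St : S != setT by apply/eqP=> /setP/(_ v); rewrite !inE eqxx.
  have LS i u : u \in L i -> u \in S.
    by move=> ui; rewrite !inE andbT; apply/eqP=> E; apply: nv; exists i; rewrite -E.
  have [_ _ pb _] := ct.
  have xL : x \in L ord0.
    by have /and4P[] := pb ord0; case: (L ord0) => //= a s /eqP[->]; rewrite mem_head.
  have yL : y \in L ord0.
    have /and4P[] := pb ord0; case: (L ord0) => //= a s _ /eqP<- _ _; exact: mem_last.
  pose x' : induced S := Sub x (LS _ _ xL); pose y' : induced S := Sub y (LS _ _ yL).
  (* Every vertex of [L i] is in [S], so [insub] discards nothing and [map val] recovers [L i]. *)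
  pose L' i : seq (induced S) := pmap insub (L i).
  have EL : (fun i => map val (L' i)) =1 L.
    move=> i; rewrite /L' pmap_filter; last exact: insubK.
    by apply/all_filterP/allP=> u /LS uS; rewrite /= isSome_insub.
  have nr : ~ theta_ring (induced S); last by apply: nr; exact: mf.
  apply/nring; exists x', y', L'; split.
    apply/val_chorded_theta; case: ct => a b c d; split=> //= [i|i j].
      by have := EL i => /= ->.
    by have := EL i; have := EL j => /= -> ->; exact: d.
  move/val_disjoint_transversal => [t tt ti]; apply: nt; exists t => // i.
  by have := ti i; have := EL i => /= ->.
case=> ex cov; split; first exact/nring.
move=> S St; apply: NNPP => /nring [x [y [L [ct nt]]]].
case/negP: St; apply/eqP/setP=> v; rewrite inE.
have b : bad_theta (val x) (val y) (fun i => map val (L i)).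
  by split; [apply/val_chorded_theta|move/val_disjoint_transversal].
by case: (cov _ _ _ b v) => i /mapP[u _ ->]; exact: valP.
Qed.

Ltac clear_non_arith :=
  repeat match goal with
  | H : ?T |- _ =>
    lazymatch T with
    | is_true (leq _ _) => fail
    | is_true (andb _ _) => fail
    | is_true (orb _ _) => fail
    | is_true (negb _) => fail
    | is_true (@eq_op _ _ _) => fail
    | or _ _ => fail
    | and _ _ => fail
    | @eq bool _ _ => fail
    | @eq ?A _ _ => unify A nat; fail
    | not (@eq ?A _ _) => unify A nat; fail
    | _ => clear H
    end
  end.
Ltac slia := intros; clear_non_arith; simpl in *; lia.

(** * Induced cycles *)

Section Cycles.
Variable G : sgraph.
Implicit Types (x y u v w z : G) (p q c s t : seq G) (L : 'I_3 -> seq G).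

(** Stated by indices, so that adjacency becomes arithmetic; the default [x0] is never reached
    because the indices are below [size p]. *)
Definition induced_path p : Prop :=
  uniq p /\
  forall x0 i j, i < j < size p -> (nth x0 p i -- nth x0 p j) = (j == i.+1).

Lemma next_nthE x0 c i : uniq c -> i < size c ->
  next c (nth x0 c i) = nth x0 c (if i.+1 == size c then 0 else i.+1).
Proof.
case: c => // a c U lt; rewrite next_nth mem_nth // index_uniq //=.
case: ifP => [/eqP[E]|/eqP ne]; first by rewrite nth_default ?E.
apply: set_nth_default; move: lt ne => /=; slia.
Qed.

Lemma induced_cycleP x0 c :
  induced_cycle c <->
  [/\ 2 < size c, uniq c &
      forall i j, i < j < size c ->
        (nth x0 c i -- nth x0 c j) = (j == i.+1) || ((i == 0) && (j == (size c).-1))].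
Proof.
have step i j : uniq c -> i < j < size c ->
    (next c (nth x0 c i) == nth x0 c j) || (next c (nth x0 c j) == nth x0 c i) =
    (j == i.+1) || ((i == 0) && (j == (size c).-1)).
  move=> U /andP[ij jc]; have ic := ltn_trans ij jc.
  rewrite !next_nthE // !nth_uniq //.
  - by case: (j.+1 =P _) => ?; case: (i.+1 =P _) => ?; slia.
  - by case: ifP => /eqP ?; slia.
  - by case: ifP => /eqP ?; slia.
split=> -[c2 U E]; split=> //.
  move=> i j ijc; rewrite -step //; apply: E; apply: mem_nth; slia.
move=> u v /(nthP x0)[i ic <-] /(nthP x0)[j jc <-].
case: (ltngtP i j) => [ij|ij|<-].
- by rewrite E ?ij // -step ?ij.
- by rewrite sedgeC orbC E ?ij // -step ?ij.
rewrite sedge_irr orbb next_nthE // nth_uniq //; last by case: ifP => /eqP ?; slia.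
by case: ifP => /eqP ?; slia.
Qed.

Lemma prev_nextE c u v : uniq c -> (prev c u == v) = (next c v == u).
Proof.
move=> U; apply/eqP/eqP=> [<-|<-]; first exact: next_prev.
exact: prev_next.
Qed.

Lemma induced_cycle_rot n c : induced_cycle (rot n c) <-> induced_cycle c.
Proof.
have imp m c' : induced_cycle c' -> induced_cycle (rot m c').
  case=> c2 U E; split; rewrite ?size_rot ?rot_uniq //.
  by move=> u v; rewrite !mem_rot !next_rot //; exact: E.
split; last exact: imp.
by move/(imp (size (rot n c) - n)); rewrite -[rot _ (rot n c)]/(rotr n (rot n c)) rotK.
Qed.

Lemma induced_cycle_rev c : induced_cycle (rev c) <-> induced_cycle c.
Proof.
have imp c' : induced_cycle c' -> induced_cycle (rev c').
  case=> c2 U E; split; rewrite ?size_rev ?rev_uniq //.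
  by move=> u v; rewrite !mem_rev => uc vc; rewrite !next_rev // E // !prev_nextE // orbC.
by split=> [/imp|/imp //]; rewrite revK.
Qed.

Lemma induced_cycle_degree c u n1 n2 n3 : induced_cycle c -> u \in c ->
  n1 \in c -> n2 \in c -> n3 \in c -> u -- n1 -> u -- n2 -> u -- n3 ->
  [|| n1 == n2, n1 == n3 | n2 == n3].
Proof.
case=> c2 U E uc c1' c2' c3'; rewrite !E // -!(prev_nextE u) //.
rewrite !(eq_sym (next c u)) !(eq_sym (prev c u)).
do 3 (case/orP=> /eqP->); by rewrite ?eqxx ?orbT.
Qed.

Lemma next_neq_prev c u : uniq c -> 2 < size c -> u \in c -> next c u != prev c u.
Proof.
move=> U c2 /(nthP u)[i ic <-]; rewrite eq_sym prev_nextE //.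
have lt : (if i.+1 == size c then 0 else i.+1) < size c by case: ifP => /eqP ?; slia.
rewrite !next_nthE // nth_uniq //; last by case: (_ =P size c); slia.
by case: (i.+1 =P _) => ?; case: ifP => /eqP ?; slia.
Qed.

(** In [c'] every vertex has two distinct neighbours, its successor and its predecessor. It has no
    third one among the vertices of [c], so [c'] has no chord. *)
Lemma hamiltonian_induced_cycle c c' :
  induced_cycle c -> uniq c' -> cycle (@sedge G) c' -> c' =i c -> induced_cycle c'.
Proof.
move=> ic U' cy E; have [c2 U Ec] := ic.
have sz : size c' = size c by apply/perm_size/uniq_perm.
split; rewrite ?sz // => u v uc vc.
have nu := next_cycle cy uc; have pu := prev_cycle cy uc.
apply/idP/orP=> [uv|[]/eqP<-]; [|exact: nu|by rewrite sedgeC; exact: next_cycle].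
have upu : u -- prev c' u by rewrite sedgeC.
have := induced_cycle_degree ic _ _ _ _ nu upu uv.
rewrite -!E mem_next mem_prev uc vc => /(_ isT isT isT isT).
by rewrite (negbTE (next_neq_prev _ _ _)) ?sz //= prev_nextE // => /orP.
Qed.

Lemma induced_path_rev p : induced_path p -> induced_path (rev p).
Proof.
case=> U E; split; first by rewrite rev_uniq.
move=> x0 i j; rewrite size_rev => ij; rewrite !nth_rev; try slia.
rewrite sedgeC E; slia.
Qed.

Lemma induced_cycle_prefix s t :
  induced_cycle (s ++ t) -> t != [::] -> induced_path s.
Proof.
move=> ic nt; have x0 : G by case: t nt {ic}.
split=> [|x1]; first by case: ic => _; rewrite cat_uniq => /and3P[].
case/(induced_cycleP x0): ic => _ _ E i j ij.
rewrite !(set_nth_default x0); try slia.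
have := E i j; rewrite !nth_cat size_cat.
have -> : i < size s by slia.
have -> : j < size s by slia.
have : 0 < size t by rewrite lt0n size_eq0.
move=> st ->; slia.
Qed.

(** Reversing [t] puts the two last entries next to each other and the two heads at the ends of the
    list, so these two edges close the cycle. The size bound excludes two single vertices. *)
Lemma cat_rev_induced_cycle x0 s t :
  induced_path s -> induced_path t -> s != [::] -> t != [::] -> 2 < size s + size t ->
  {in s, forall u, u \notin t} ->
  {in s & t, forall u v, (u -- v) =
     (u == head x0 s) && (v == head x0 t) || (u == last x0 s) && (v == last x0 t)} ->
  induced_cycle (s ++ rev t).
Proof.
move=> [Us Es] [Ut Et]; rewrite -!size_eq0 => s0 t0 st D E; apply/(induced_cycleP x0).
have Eidx i j : i < size s -> j < size t -> (nth x0 s i -- nth x0 t j) =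
    ((i == 0) && (j == 0)) || ((i == (size s).-1) && (j == (size t).-1)).
  move=> ilt jlt; rewrite E ?mem_nth // -!nth0 -!nth_last !nth_uniq //; slia.
rewrite size_cat size_rev; split=> //.
  rewrite cat_uniq rev_uniq Us Ut andbT /=; apply/hasPn => v; rewrite mem_rev => vt.
  by apply: contraL vt => /D.
move=> i j ij; rewrite !nth_cat; case: ltnP => ilt; case: ltnP => jlt.
- rewrite Es; slia.
- rewrite nth_rev ?Eidx; slia.
- slia.
rewrite !nth_rev; try slia.
rewrite sedgeC Et; slia.
Qed.

Lemma zip_beheadP x0 p u v :
  reflect (exists i, [/\ i.+1 < size p, u = nth x0 p i & v = nth x0 p i.+1])
          ((u, v) \in zip p (behead p)).
Proof.
elim: p => [|a [|b p] IH] /=.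
- by constructor=> -[i []].
- by constructor=> -[i []].
rewrite in_cons; apply: (iffP orP) => [[/eqP[-> ->]|/IH[i [lt -> ->]]]|].
- by exists 0.
- by exists i.+1.
case=> -[|i] [lt eu ev]; first by left; rewrite eu ev.
by right; apply/IH; exists i.
Qed.

Lemma path_edge_nth x0 p i j : uniq p -> i < size p -> j < size p ->
  path_edge p (nth x0 p i) (nth x0 p j) = (j == i.+1) || (i == j.+1).
Proof.
move=> U ilt jlt; rewrite /path_edge; congr (_ || _).
  apply/(zip_beheadP x0)/eqP=> [[k [lt /eqP + /eqP]]|E].
    by rewrite !nth_uniq //; [slia|slia].
  by exists i; rewrite -E.
apply/(zip_beheadP x0)/eqP=> [[k [lt /eqP + /eqP]]|E].
  by rewrite !nth_uniq //; [slia|slia].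
by exists j; rewrite -E.
Qed.

Lemma path_edgeC p u v : path_edge p u v = path_edge p v u.
Proof. exact: orbC. Qed.

Lemma path_edge_mem p u v : path_edge p u v -> (u \in p) && (v \in p).
Proof.
wlog: u v / (u, v) \in zip p (behead p) => [H|].
  by case/orP=> h; [|rewrite andbC]; apply: H => //; rewrite /path_edge h.
by case/(zip_beheadP u)=> i [lt -> ->] _; rewrite !mem_nth // ltnW.
Qed.

Lemma path_edge_sedge p u v : sorted (@sedge G) p -> path_edge p u v -> u -- v.
Proof.
move=> so; wlog: u v / (u, v) \in zip p (behead p) => [H|].
  by case/orP=> h; [|rewrite sedgeC]; apply: H => //; rewrite /path_edge h.
case/(zip_beheadP u)=> i [lt eu ->] _; rewrite {1}eu; exact: (sortedP u so).

Qed.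

End Cycles.

(** * Configurations and their chorded thetas *)

Definition i0 : 'I_3 := @Ordinal 3 0 isT.
Definition i1 : 'I_3 := @Ordinal 3 1 isT.
Definition i2 : 'I_3 := @Ordinal 3 2 isT.

Lemma forall_ord3 (P : 'I_3 -> Prop) : P i0 -> P i1 -> P i2 -> forall i, P i.
Proof.
by move=> p0 p1 p2 [[|[|[|i]]] lt] //; rewrite (bool_irrelevance lt isT).
Qed.

Lemma forall_ord3_lt (P : 'I_3 -> 'I_3 -> Prop) :
  P i0 i1 -> P i0 i2 -> P i1 i2 -> forall i j : 'I_3, i < j -> P i j.
Proof. by move=> p01 p02 p12; elim/forall_ord3; elim/forall_ord3. Qed.

Lemma forall_ord3_neq (P : 'I_3 -> 'I_3 -> Prop) :
  (forall i j, P i j -> P j i) -> (forall i j : 'I_3, i < j -> P i j) ->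
  forall i j, i != j -> P i j.
Proof.
move=> sP lP i j; case: (ltngtP i j) => [/lP //|/lP /sP //|/val_inj->].
by rewrite eqxx.
Qed.

Lemma third_ord3 (i j : 'I_3) : exists k, (k != i) && (k != j).
Proof.
by move: i j; elim/forall_ord3; elim/forall_ord3;
  [exists i1|exists i2|exists i1|exists i2|exists i0|exists i0|exists i1|exists i0|exists i0].
Qed.

Lemma ord3_pigeonhole (f : 'I_3 -> bool) : exists i j, i != j /\ f i = f j.
Proof.
case: (boolP (f i0 == f i1)) => [/eqP E|n01]; first by exists i0, i1.
case: (boolP (f i0 == f i2)) => [/eqP E|n02]; first by exists i0, i2.
by exists i1, i2; split=> //; case: (f i0) (f i1) (f i2) n01 n02 => [] [] [].
Qed.

Section Configurations.
Variable G : sgraph.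
Implicit Types (u v w x y z : G) (r : seq G) (L P : 'I_3 -> seq G).

(** A configuration inside [G] rather than one filling [G]: this and the next three predicates leave
    out the covering condition, which minimality supplies later. *)
Definition wheel_on z (r : seq G) u v : Prop :=
  [/\ induced_cycle r, z \notin r, u \in r /\ v \in r, z -- u /\ z -- v &
      u != v /\ ~~ (u -- v)].

Definition theta_on x y P : Prop :=
  [/\ x != y, ~~ (x -- y),
      forall i : 'I_3, path_between x y (P i) &
      forall i j : 'I_3, i < j -> union_induced_cycle (P i) (P j)].

Definition pyramid_on w (z : 'I_3 -> G) P : Prop :=
  [/\ triangle z,
      forall i : 'I_3, path_between w (z i) (P i),
      forall i j : 'I_3, i < j ->
        path_vertices (P i) :&: path_vertices (P j) = [set w] /\
        induces_cycle (path_vertices (P i) :|: path_vertices (P j)) &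
      #|[set i : 'I_3 | path_length (P i) == 1]| <= 1].

Definition prism_on (x y : 'I_3 -> G) L : Prop :=
  [/\ [/\ triangle x, triangle y &
          [disjoint triangle_vertices x & triangle_vertices y]],
      forall i : 'I_3, path_between (x i) (y i) (L i),
      forall i j : 'I_3, i < j ->
        [disjoint path_vertices (L i) & path_vertices (L j)] &
      forall i j : 'I_3, i < j ->
        induces_cycle (path_vertices (L i) :|: path_vertices (L j))].

Definition has_configuration : Prop :=
  [\/ exists z r u v, wheel_on z r u v,
      exists (x y : 'I_3 -> G) L, prism_on x y L,
      exists w (z : 'I_3 -> G) P, pyramid_on w z P |
      exists x y P, theta_on x y P].

End Configurations.

(** * Cuts separating the ends of a chorded theta *)

Section Cut.
Variable G : sgraph.
Implicit Types (x y u v w z : G) (p q c s t : seq G) (L : 'I_3 -> seq G).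

Lemma path_betweenP x y p : path_between x y p ->
  exists s, [/\ p = x :: s, last x s = y, uniq (x :: s) & path (@sedge G) x s].
Proof.
by case/and4P; case: p => //= a s /eqP[->] /eqP <- U so; exists s.
Qed.

Lemma path_between_rev x y p : path_between x y p -> path_between y x (rev p).
Proof.
case/path_betweenP=> s [-> ls U pa]; rewrite /path_between rev_uniq U rev_sorted.
rewrite (eq_sorted (fun u v => sedgeC v u)).
rewrite /= pa rev_cons last_rcons eqxx !andbT -{}ls.
by case/lastP: s {U pa} => //= s a; rewrite rev_rcons last_rcons.
Qed.

Lemma chorded_theta_sym x y L :
  chorded_theta x y L -> chorded_theta y x (fun i => rev (L i)).
Proof.
case=> xy nxy pb D; split; [by rewrite eq_sym|by rewrite sedgeC|move=> i|move=> i j ij].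
  exact: path_between_rev.
have E p : path_vertices (rev p) = path_vertices p.
  by apply/setP=> v; rewrite !inE mem_rev.
by rewrite !E D // setUC.
Qed.

Lemma path_crossing (A : {set G}) x s : path (@sedge G) x s ->
  (x \in A) != (last x s \in A) ->
  exists a b, [/\ a \in A, b \notin A, a -- b, a \in x :: s & b \in x :: s].
Proof.
elim: s x => [|u s IH] x /=; first by rewrite eqxx.
case/andP=> xu pa ne; have [E|ne'] := eqVneq (x \in A) (u \in A).
  rewrite E in ne; case: (IH _ pa ne) => a [b [aA bA ab aS bS]].
  by exists a, b; split; rewrite // in_cons ?aS ?bS orbT.
case: (boolP (x \in A)) ne' => xA; case: (boolP (u \in A)) => uA // _.
  by exists x, u; rewrite !inE !eqxx orbT.
by exists u, x; rewrite !inE !eqxx orbT sedgeC.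
Qed.

(* Two of the paths can only cross in a common vertex at [x] or [y], and these
   are not adjacent; so the three crossing edges are pairwise distinct. *)
Lemma chorded_theta_cut x y L (A : {set G}) :
  chorded_theta x y L -> (x \in A) != (y \in A) ->
  exists e : 'I_3 -> G * G,
    [/\ forall i, [/\ (e i).1 \in A, (e i).2 \notin A, (e i).1 -- (e i).2,
          (e i).1 \in L i & (e i).2 \in L i],
        forall i j, i != j -> (e i).2 = (e j).2 -> (e i).2 = x \/ (e i).2 = y &
        injective e].
Proof.
move=> ct ne; have [xy nxy pb _] := ct.
have: forall i, exists e : G * G, 
   [/\ e.1 \in A, e.2 \notin A, e.1 -- e.2, e.1 \in L i & e.2 \in L i].
  move=> i; case/path_betweenP: (pb i) => s [-> ls _ pa].
  by rewrite -ls in ne; case: (path_crossing pa ne) => a [b]; exists (a, b).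
case/fin_all_exists=> e eP; exists e; split=> // [i j ij E|i j E].
  by apply: (chorded_theta_disj ct ij); [|rewrite E]; have [] := eP i; have [] := eP j.
apply/eqP; apply: contraT => ij; have [aA bA ab ai bi] := eP i; have [_ _ _ aj bj] := eP j.
rewrite -!E in aj bj.
have xe := chorded_theta_disj ct ij ai aj; have ye := chorded_theta_disj ct ij bi bj.
move: aA bA ab nxy; case: xe => ->; case: ye => ->; rewrite ?(sedgeC y x); do ?[by move->].
  by move=> _ _ ->.
by move=> _ _ ->.
Qed.

(** Cut off the single vertex [x]: the three crossing edges are distinct and all start at [x], so
    their other ends are distinct. *)
Lemma chorded_theta_degree x y L : chorded_theta x y L ->
  exists n : 'I_3 -> G, injective n /\ forall i, x -- n i /\ n i \in L i.
Proof.
move=> ct; have [xy _ _ _] := ct.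
have [|e [eP _ inj]] := @chorded_theta_cut x y L [set x] ct.
  by rewrite !inE eqxx [y == x]eq_sym (negbTE xy).
have e1 i : (e i).1 = x by have [/set1P] := eP i.
exists (fun i => (e i).2); split=> [i j E|i].
  by apply: inj; case: (e i) (e j) (e1 i) (e1 j) E => ? ? [? ?] /= -> -> ->.
by have [_ _ + _ ->] := eP i; rewrite e1.
Qed.

End Cut.

(** * Three rungs between two ends *)

Section Rungs.
Variable G : sgraph.
Implicit Types (u v w z : G) (p q c s t : seq G) (x y : 'I_3 -> G)
  (L : 'I_3 -> seq G).

(* What prisms, pyramids and thetas have in common: three paths joining two
   ends, each of which is either a triangle or a single vertex. *)
Record rungs x y L : Prop := Rungs {
  rungs_path : forall i, path_between (x i) (y i) (L i);
  rungs_top : (forall i j, i != j -> x i -- x j) \/ (forall i j, x i = x j);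
  rungs_bot : (forall i j, i != j -> y i -- y j) \/ (forall i j, y i = y j);
  rungs_neq : forall i j, x i != y j;
  rungs_meet : forall i j v, i != j -> v \in L i -> v \in L j ->
    (forall k, v = x k) \/ (forall k, v = y k);
  rungs_edge : forall i j u v, u \in L i -> v \in L j -> u -- v ->
    [\/ exists k, path_edge (L k) u v,
        exists k l, u = x k /\ v = x l |
        exists k l, u = y k /\ v = y l] }.

Section Theory.
Variables (x y : 'I_3 -> G) (L : 'I_3 -> seq G).
Hypothesis R : rungs x y L.

Lemma rungs_uniq i : uniq (L i).
Proof. by case/path_betweenP: (rungs_path R i) => s [->]. Qed.

Lemma mem_rungs_top i : x i \in L i.
Proof. by case/path_betweenP: (rungs_path R i) => s [-> *]; rewrite mem_head. Qed.

Lemma mem_rungs_bot i : y i \in L i.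
Proof. by case/path_betweenP: (rungs_path R i) => s [-> <- *]; rewrite mem_last. Qed.

Lemma rungs_topI k j : x k \in L j -> x k = x j.
Proof.
move=> kj; have [->//|ne] := eqVneq k j.
case: (rungs_meet R ne (mem_rungs_top k) kj) => // E.
by have := rungs_neq R k k; rewrite (E k) eqxx.
Qed.

Lemma rungs_botI k j : y k \in L j -> y k = y j.
Proof.
move=> kj; have [->//|ne] := eqVneq k j.
case: (rungs_meet R ne (mem_rungs_bot k) kj) => // E.
by have := rungs_neq R k k; rewrite -(E k) eqxx.
Qed.

Lemma index_rungs_top i : index (x i) (L i) = 0.
Proof. by case/path_betweenP: (rungs_path R i) => s [-> *] /=; rewrite eqxx. Qed.

Lemma index_rungs_bot i : index (y i) (L i) = (size (L i)).-1.
Proof.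
case/path_betweenP: (rungs_path R i) => s [-> <- U _]; exact: index_last.
Qed.

End Theory.

Lemma path_edge_index p u v : uniq p -> path_edge p u v ->
  index v p = (index u p).+1 \/ index u p = (index v p).+1.
Proof.
move=> U e; have /andP[up vp] := path_edge_mem e.
move: e; rewrite -{1}(nth_index u up) -{1}(nth_index u vp).
by rewrite path_edge_nth ?index_mem // => /orP[]/eqP; [left|right].
Qed.

(** A neighbour along the path stands right before or right after [u]; of three neighbours, two
    stand on the same side and so coincide. *)
Lemma path_edge_degree p u (n : 'I_3 -> G) : uniq p ->
  (forall i, path_edge p u (n i)) -> ~ injective n.
Proof.
move=> U e inj.
have [i [j [ij E]]] := ord3_pigeonhole (fun i => index (n i) p == (index u p).+1).
have /andP[_ mi] := path_edge_mem (e i); have /andP[_ mj] := path_edge_mem (e j).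
case/eqP: ij; apply: inj; apply: (index_inj u mi mj) => /=.
move: E; case: (path_edge_index U (e i)) (path_edge_index U (e j)) => [|] ? [|] ?; slia.
Qed.

(** All edges at a vertex that is neither a top nor a bottom are edges of its own path, which
    provides at most two neighbours. *)
Lemma rungs_degree x y L u (n : 'I_3 -> G) : rungs x y L ->
  (forall v, exists i, v \in L i) -> injective n -> (forall i, u -- n i) ->
  (exists k, u = x k) \/ (exists k, u = y k).
Proof.
move=> R cov inj un; apply: NNPP => nu; case: (cov u) => i ui.
apply: (@path_edge_degree (L i) u n (rungs_uniq R i)) => // j.
have [k nk] := cov (n j).
case: (rungs_edge R ui nk (un j)) => [[l e]|[l [m [ul _]]]|[l [m [ul _]]]]; last 2 first.
- by case: nu; left; exists l.
- by case: nu; right; exists l.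
have /andP[ul _] := path_edge_mem e; have [->//|il] := eqVneq i l.
case: (rungs_meet R il ui ul) => E; case: nu; [left|right]; by exists i.
Qed.

(** Both ends of the chorded theta have degree at least three, so one is a top and the other a
    bottom. If the theta missed [v], its three paths would cross a cut in which, without [v], only
    the first edges of two rungs are available. *)
Lemma rungs_cover x y L a b L' : rungs x y L -> (forall v, exists i, v \in L i) ->
  chorded_theta a b L' -> forall v, exists i, v \in L' i.
Proof.
move=> R cov ct v; apply: NNPP => nv; have [ab nab _ _] := ct.
have [j vj] := cov v.
(* [A] is the top together with the part of the path of [v] above [v]; only
   the other two paths leave it. *)
pose A := [set u | [exists k, u == x k] || (u \in take (index v (L j)) (L j))].
have xA k : x k \in A by rewrite inE; apply/orP; left; apply/existsP; exists k.
have inT u : u \in L j -> (u \in take (index v (L j)) (L j)) = (index u (L j) < index v (L j)).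
  exact: in_take.
have yA k : y k \notin A.
  rewrite inE negb_or; apply/andP; split.
    by apply/existsP => -[l /eqP E]; have := rungs_neq R l k; rewrite E eqxx.
  apply/negP=> kT; have kj := mem_take kT.
  have E := rungs_botI R kj; rewrite E in kT kj; rewrite inT // (index_rungs_bot R) // in kT.
  have := vj; rewrite -index_mem; slia.
have cross u w : u \in A -> w \notin A -> u -- w -> u != v -> w != v ->
    exists k, [/\ k != j, u = x k & path_edge (L k) u w].
  move=> uA wA uw unv wnv; have [m um] := cov u; have [n wn] := cov w.
  case: (rungs_edge R um wn uw) => [[k e]|[k [l [_ E]]]|[k [l [E _]]]]; last 2 first.
  - by rewrite E xA in wA.
  - by rewrite E (negbTE (yA k)) in uA.
  have /andP[uk wk] := path_edge_mem e.
  have [E|kj] := eqVneq k j; last first.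
    exists k; split=> //; move: (uA); rewrite inE => /orP[/existsP[l /eqP E]|uT].
      by rewrite E in uk *; exact: (rungs_topI R uk).
    case: (rungs_meet R kj uk (mem_take uT)) => // E.
    by rewrite (E j) (negbTE (yA j)) in uA.
  (* On the path of [v] the ends of a crossing edge would have indices strictly on either side of
     the index of [v], yet consecutive. *)
  rewrite {}E {k} in uk wk e.
  have lt1 : index u (L j) < index v (L j).
    move: uA; rewrite inE => /orP[/existsP[l /eqP E]|]; last by rewrite inT.
    rewrite E in uk unv *; rewrite (rungs_topI R uk) (index_rungs_top R) // lt0n.
    apply: contraNneq unv => v0; rewrite (rungs_topI R uk).
    apply/eqP; apply: (@index_inj _ v (L j)) => //; first exact: (mem_rungs_top R).
      by rewrite /= (index_rungs_top R).
  have lt2 : index w (L j) >= index v (L j).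
    by move: wA; rewrite inE negb_or => /andP[_]; rewrite inT // -leqNgt.
  have ne : index w (L j) != index v (L j).
    by apply: contraNneq wnv => E; apply/eqP; apply: (@index_inj _ v (L j)).
  by case: (path_edge_index (rungs_uniq R j) e); slia.
have [n [ni nP]] := chorded_theta_degree ct.
have [n' [ni' nP']] := chorded_theta_degree (chorded_theta_sym ct).
(* Two tops are equal or adjacent, and so are two bottoms, but [a] and [b] are distinct and not
   adjacent; so [A] separates them. *)
have sep : (a \in A) != (b \in A).
  case: (rungs_degree R cov ni (fun i => (nP i).1)) => -[k ak];
  case: (rungs_degree R cov ni' (fun i => (nP' i).1)) => -[l bl];
    rewrite ak bl ?xA ?(negbTE (yA _)) //.
    case: (rungs_top R) => T; last by rewrite ak bl (T k l) eqxx in ab.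
    by rewrite ak bl T // in nab; apply: contraNneq ab => E; rewrite ak bl E.
  case: (rungs_bot R) => T; last by rewrite ak bl (T k l) eqxx in ab.
  by rewrite ak bl T // in nab; apply: contraNneq ab => E; rewrite ak bl E.
have [e [eP _ ei]] := chorded_theta_cut ct sep.
have: forall i, exists k, [/\ k != j, (e i).1 = x k & path_edge (L k) (e i).1 (e i).2].
  move=> i; have [eA neA e12 m1 m2] := eP i.
  apply: cross => //; apply/eqP=> E; apply: nv; exists i; by rewrite -E.
case/fin_all_exists=> f fP.
(* A crossing edge is determined by its rung, being the edge from index 0 to index 1. So three
   distinct edges need three rungs, and [j] would be one of them. *)
have fi : injective f.
  move=> i k E; have [_ u1 p1] := fP i; have [_ u2 p2] := fP k.
  rewrite -E -u1 in u2; rewrite -E u2 in p2; apply: ei.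
  case: (e i) (e k) u1 u2 p1 p2 => [? ?] [? ?] /= -> -> p1 p2; congr pair.
  have U := rungs_uniq R (f i).
  have /andP[_ m1] := path_edge_mem p1; have /andP[_ m2] := path_edge_mem p2.
  apply: (@index_inj _ a (L (f i))) => //=.
  case: (path_edge_index U p1) (path_edge_index U p2);
    rewrite (index_rungs_top R); slia.
have [g _ gK] := injF_bij fi.
by have [/eqP] := fP (g j); rewrite gK.
Qed.

(** The theta joins [x j] to [y k]: a rung starting elsewhere is prolonged by an edge to [x j], one
    ending elsewhere by an edge to [y k]. In a transversal the vertices on paths [j] and [k] would
    be adjacent, but every edge between these two rungs has [x j] or [y k] as an end. *)
Lemma rungs_bad x y L j k : rungs x y L -> j != k -> ~~ (x j -- y k) ->
  exists a b M, bad_theta a b M /\ forall i v, v \in M i -> exists l, v \in L l.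
Proof.
move=> R jk nadj.
(* With a boolean count, [nseq] adds the vertex once or not at all, so that no end is repeated. *)
pose M i := nseq (x i != x j) (x j) ++ L i ++ nseq (y i != y k) (y k).
have inM i u : (u \in M i) = [|| (u == x j), u == y k | u \in L i].
  rewrite !mem_cat !mem_nseq !lt0b.
  apply/or3P/or3P=> [[/andP[_ ->]|->|/andP[_ ->]]|[/eqP->|/eqP->|->]];
    rewrite ?eqxx ?andbT; try by [constructor 1|constructor 2|constructor 3].
  - case: (eqVneq (x i) (x j)) => [<-|_]; last by constructor 1.
    by constructor 2; exact: (mem_rungs_top R).
  case: (eqVneq (y i) (y k)) => [<-|_]; last by constructor 3.
  by constructor 2; exact: (mem_rungs_bot R).
exists (x j), (y k), M; split; last first.
  move=> i v; rewrite inM => /or3P[/eqP->|/eqP->|vi]; last by exists i.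
  - by exists j; exact: (mem_rungs_top R).
  by exists k; exact: (mem_rungs_bot R).
have topI i : x j \in L i -> x i = x j by move/(rungs_topI R).
have botI i : y k \in L i -> y i = y k by move/(rungs_botI R).
split.
  split=> //; first exact: (rungs_neq R _ _).
    move=> i; have [s [Li ls U pa]] := path_betweenP (rungs_path R i).
    have U' : uniq (M i).
      have Un (b : bool) u : uniq (nseq b u) by case: b.
      rewrite /M !cat_uniq (rungs_uniq R) !Un //= !andbT.
      apply/andP; split; apply/hasPn => u.
        rewrite /= mem_cat !mem_nseq !lt0b => um; apply/negP=> /andP[/eqP ne /eqP E].
        rewrite {}E in um; case/orP: um => [/topI //|/andP[_ /eqP E]].
        by have := rungs_neq R j k; rewrite E eqxx.
      rewrite mem_nseq lt0b => /andP[ne /eqP->]; apply: contra ne => /botI ->.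
      exact: eqxx.
    rewrite /path_between U' /M /=; apply/and3P; split=> //.
    - by case: (eqVneq (x i) (x j)) => [<-|] //=; rewrite Li.
    - rewrite Li; case: (eqVneq (x i) (x j)) => _; case: (eqVneq (y i) (y k)) => [<-|_] /=;
      by rewrite ?last_cat /= ?cats0 ?ls.
    have top : x i != x j -> x j -- x i.
      case: (rungs_top R) => [T ne|T]; last by rewrite (T i j) eqxx.
      by apply: T; apply: contraNneq ne => ->.
    have bot : y i != y k -> y i -- y k.
      case: (rungs_bot R) => [T ne|T]; last by rewrite (T i k) eqxx.
      by apply: T; apply: contraNneq ne => ->.
    rewrite Li; case: (eqVneq (x i) (x j)) top => [_ _|_ /(_ isT) top];
      case: (eqVneq (y i) (y k)) bot => [_ _|_ /(_ isT) bot] /=;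
      by rewrite ?cats0 ?cat_path ?ls /= ?pa ?andbT ?top ?bot.
  move=> i l il; apply/setP=> u; rewrite !inE !inM.
  case: eqP => //= E1; case: eqP => //= E2; apply/negP=> /andP[ui ul].
  have il' : i != l by apply: contraTneq il => ->; rewrite ltnn.
  by case: (rungs_meet R il' ui ul) => E; [apply: E1|apply: E2].
case=> t tt tM.
have tL i : [/\ t i <> x j, t i <> y k & t i \in L i].
  have := tM i; rewrite in_interior inM => /and3P[/eqP E1 /eqP E2].
  by case/or3P=> [/eqP|/eqP|].
have [uj uk ui] := tL j; have [vj vk vi] := tL k.
have meetN i l w : i != l -> w \in L i -> w \in L l -> w = x j \/ w = y k.
  move=> il wi wl; case: (rungs_meet R il wi wl) => E; [left|right]; exact: E.
case: (rungs_edge R ui vi (tt _ _ jk)) => [[l e]|[l [m [E _]]]|[l [m [_ E]]]].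
- have /andP[ul vl] := path_edge_mem e; have [E|lj] := eqVneq l j.
    by rewrite E in vl; case: (meetN _ _ _ jk vl vi).
  by case: (meetN _ _ _ lj ul ui).
- by apply: uj; rewrite E in ui *; exact: (rungs_topI R ui).
by apply: vk; rewrite E in vi *; exact: (rungs_botI R vi).
Qed.

End Rungs.

(** * Chorded thetas in wheels *)

Section Wheels.
Variable G : sgraph.
Implicit Types (x y u v w z : G) (p q c s t : seq G) (L : 'I_3 -> seq G).

Definition tuple3 (T : Type) (a b c : T) (i : 'I_3) : T :=
  match val i with 0 => a | 1 => b | _ => c end.

Lemma induced_cycle_sedge c : induced_cycle c -> cycle (@sedge G) c.
Proof.
case=> c2 U E; apply: cycle_from_next => // u uc.
by rewrite E ?mem_next // eqxx.
Qed.

Lemma induced_cycle_split u s v t a b :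
  induced_cycle (u :: s ++ v :: t) -> a \in s -> b \in t -> ~~ (a -- b).
Proof.
move=> /(induced_cycleP u)[_ _ E] /(nthP u)[i ilt <-] /(nthP u)[j jlt <-].
have := E i.+1 (size s + j.+1).+1.
rewrite /= !nth_cat ilt (_ : size s + j.+1 < size s = false); last slia.
rewrite addKn size_cat /= => ->; slia.
Qed.

(** [u] and [v] are joined by the two arcs of the rim and by the path through [z]. A transversal
    would contain adjacent vertices from the interiors of the two arcs, which [induced_cycle_split]
    excludes. *)
Lemma wheel_bad z c u v : wheel_on z c u v ->
  exists a b L, bad_theta a b L /\ forall i w, w \in L i -> w \in z :: c.
Proof.
case=> ic zc [uc vc] [zu zv] [uv nuv].
have [n c' Ec] := rot_to uc.
have cE w : (w \in c) = (w \in u :: c') by rewrite -Ec mem_rot.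
have {}ic : induced_cycle (u :: c') by rewrite -Ec; apply/induced_cycle_rot.
have : v \in c' by move: vc; rewrite cE in_cons eq_sym (negbTE uv).
move=> vc'; case/splitPr: c' / vc' => s t in Ec cE ic *.
have := induced_cycle_sedge ic; rewrite /= rcons_cat cat_path rcons_cons /=.
case/and3P=> ps lsv pt; have [_ U _] := ic.
have zN : z \notin u :: s ++ v :: t by rewrite -cE.
exists u, v, (tuple3 (u :: rcons s v) (rev (v :: rcons t u)) [:: u; z; v]).
move: U; rewrite cons_uniq cat_uniq cons_uniq.
case/and4P=> uN Us /hasPn stv /andP[vt Ut].
have /and3P[us _ ut] : [&& u \notin s, u != v & u \notin t].
  by move: uN; rewrite mem_cat in_cons !negb_or.
have /and4P[zu' zs zv' zt] : [&& z != u, z \notin s, z != v & z \notin t].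
  by move: zN; rewrite in_cons mem_cat in_cons !negb_or.
have vs : v \notin s by apply: stv; rewrite mem_head.
have st w : w \in t -> w \notin s by move=> wt; apply: stv; rewrite in_cons wt orbT.
split; last first.
  elim/forall_ord3=> w; rewrite /tuple3 /= ?mem_rev !(inE, mem_rcons, mem_cat) cE.
  - by rewrite !(inE, mem_cat); case/or3P=> ->; rewrite ?orbT.
  - by rewrite !(inE, mem_cat); case/or3P=> ->; rewrite ?orbT.
  by rewrite !(inE, mem_cat); case/or3P=> ->; rewrite ?orbT.
split.
  split=> //; first elim/forall_ord3.
  - rewrite /path_between /tuple3 /= eqxx last_rcons eqxx rcons_uniq rcons_path.
    by rewrite mem_rcons in_cons negb_or uv us vs Us ps lsv.
  - apply: path_between_rev; rewrite /path_between /tuple3 /= eqxx last_rcons eqxx.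
    by rewrite rcons_uniq pt mem_rcons in_cons negb_or eq_sym uv vt ut Ut.
  - rewrite /path_between /tuple3 /= !eqxx !inE negb_or uv (sedgeC u z) zu zv.
    by rewrite eq_sym zu' zv'.
  set M := tuple3 _ _ _.
    apply: (@forall_ord3_lt (fun i j => path_vertices (M i) :&: path_vertices (M j) = _));
      apply/setP=> w; rewrite /M /tuple3 !inE /= ?mem_rev !(inE, mem_rcons).
    + have := st w; case: (w == u); case: (w == v); case: (w \in t); case: (w \in s) => //=.
      by move/(_ isT).
    + case: (w == u); case: (w == v) => //=; rewrite ?orbT ?orbF ?andbT //.
      by case: (w =P z) => [->|_]; rewrite ?andbF // (negbTE zs).
    case: (w == u); case: (w == v) => //=; rewrite ?orbT ?andbF ?orbF ?andbT //.
    by case: (w =P z) => [->|_]; rewrite ?andbF // (negbTE zt).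
case=> r tr ri; have := ri i0; have := ri i1; rewrite !in_interior /tuple3 /= mem_rev.
rewrite !(inE, mem_rcons) => /and3P[/negbTE-> /negbTE->] /= r1.
case/and3P=> [/negbTE-> /negbTE->] /= r0.
by have /negP := induced_cycle_split ic r0 r1; apply; apply: tr.
Qed.

(** If [v] is missed, then [v] and both ends lie on the rim. The rim without [v] is a path; cutting
    it right after an end leaves one rim edge and edges at the center to cross, too few for three
    paths. *)
Lemma wheel_cover z c x y L :
  partial_wheel z c -> chorded_theta x y L -> forall v, exists i, v \in L i.
Proof.
case=> ic zc cov ct0 v; apply: NNPP => nv0.
(* An end on the rim has three neighbours, at most two of them on the rim; so the center is on the
   theta and [v] is not the center. The center cannot be an end, for the other end would be a rim
   vertex with three neighbours on the rim. *)
have rimN a b M : chorded_theta a b M -> ~ (exists i, v \in M i) -> [/\ a \in c, v \in c & a != z].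
  move=> ct nv; have [n [ni nP]] := chorded_theta_degree ct.
  have notc : a \in c -> ~ (forall i, n i \in c).
    move=> ac nc; have := induced_cycle_degree ic ac (nc i0) (nc i1) (nc i2).
    by rewrite !(nP _).1 !(inj_eq ni) => /(_ isT isT isT).
  have az : a != z.
    apply/eqP=> E; rewrite E in ct nP.
    have [m [mi mP]] := chorded_theta_degree (chorded_theta_sym ct).
    have [zb nzb _ _] := ct.
    have bc : b \in c by move: (cov b); rewrite in_cons eq_sym (negbTE zb).
    have mc i : m i \in c.
      move: (cov (m i)); rewrite in_cons => /orP[/eqP mz|//].
      by have [+ _] := mP i; rewrite mz sedgeC (negbTE nzb).
    have := induced_cycle_degree ic bc (mc i0) (mc i1) (mc i2).
    by rewrite !(mP _).1 !(inj_eq mi) => /(_ isT isT isT).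
  have ac : a \in c by move: (cov a); rewrite in_cons (negbTE az).
  split=> //; move: (cov v); rewrite in_cons => /orP[/eqP vz|//].
  case: (notc ac) => i; move: (cov (n i)); rewrite in_cons => /orP[/eqP nz|//].
  by case: nv; exists i; rewrite vz -nz (nP i).2.
have [xc vc xz] := rimN _ _ _ ct0 nv0.
have nv0' : ~ (exists i, v \in rev (L i)).
  by case=> i; rewrite mem_rev => vi; apply: nv0; exists i.
have [yc _ yz] := rimN _ _ _ (chorded_theta_sym ct0) nv0'.
have xy : x != y by case: ct0.
have [n t Ec] := rot_to vc.
have cE w : (w \in c) = (w \in v :: t) by rewrite -Ec mem_rot.
have ic' : induced_cycle (v :: t) by rewrite -Ec; apply/induced_cycle_rot.
clear rimN nv0'.
wlog lt : x y L ct0 nv0 xc yc xz yz xy / index x t < index y t.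
  move=> H; case: (ltngtP (index x t) (index y t)) => [|gt|E]; first exact: (H _ _ _ ct0).
    apply: (H _ _ _ (chorded_theta_sym ct0)) => //; last by rewrite eq_sym.
    by case=> i; rewrite mem_rev => vi; apply: nv0; exists i.
  case/eqP: xy; have xv : x != v.
    apply/eqP=> xv; apply: nv0; exists i0; rewrite -xv.
    by case: ct0 => _ _ pb _; case/path_betweenP: (pb i0) => s [-> *]; rewrite mem_head.
  have xt : x \in t by move: xc; rewrite cE in_cons (negbTE xv).
  have yt : y \in t by rewrite -index_mem -E index_mem.
  exact: (index_inj x xt yt E).
pose A := [set u in take (index x t).+1 t].
have xv : x != v.
  apply/eqP=> xv; apply: nv0; exists i0; rewrite -xv.
  by case: ct0 => _ _ pb _; case/path_betweenP: (pb i0) => s [-> *]; rewrite mem_head.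
have xt : x \in t by move: xc; rewrite cE in_cons (negbTE xv).
have AE u : u \in t -> (u \in A) = (index u t <= index x t).
  by move=> ut; rewrite inE in_take // ltnS.
have sep : (x \in A) != (y \in A).
  rewrite AE // leqnn; apply/eqP=> /esym; have [yt|yt] := boolP (y \in t).
    by rewrite AE // leqNgt lt.
  by rewrite inE => /mem_take; rewrite (negbTE yt).
have [e [eP eV ei]] := chorded_theta_cut ct0 sep.
(* Two crossing edges both lead to the center or both avoid it. In the first case the center is a
   common vertex of two paths, hence [x] or [y]; in the second both are the same rim edge. *)
have [i [j [ij E]]] := ord3_pigeonhole (fun i => (e i).2 == z).
have other k : (e k).2 != z -> e k = (x, nth x t (index x t).+1).
  have [aA bA ab ak bk] := eP k; move=> bz.
  have bt : (e k).2 \in t.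
    have := cov (e k).2; rewrite in_cons (negbTE bz) /= cE in_cons => /orP[/eqP bv|//].
    by case: nv0; exists k; rewrite -bv.
  have at_ : (e k).1 \in t by move: aA; rewrite inE => /mem_take.
  rewrite AE // in aA; rewrite AE // -ltnNge in bA.
  have [_ _ +] := (induced_cycleP x _).1 ic'.
  move/(_ (index (e k).1 t).+1 (index (e k).2 t).+1).
  rewrite /= !nth_index // ab; have := bt; rewrite -index_mem => bs.
  have ltab : (index (e k).1 t) < (index (e k).2 t) by apply: leq_ltn_trans bA.
  rewrite orbF !ltnS ltab bs eqSS => /(_ isT) /esym /eqP Eb.
  have ax : (e k).1 = x by apply: (index_inj x at_ xt); apply/eqP; rewrite eqn_leq aA /= -ltnS -Eb.
  by rewrite [e k]surjective_pairing ax -[in LHS](nth_index x bt) Eb ax.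
have [bz|bz] := eqVneq (e i).2 z.
  move: E; rewrite bz eqxx => /esym /eqP bz'.
  case: (eV i j ij); rewrite ?bz ?bz' // => Ez; by rewrite Ez eqxx in xz yz.
move: E; rewrite (negbTE bz) => /esym /negbT bz'.
by case/eqP: ij; apply: ei; rewrite (other i) // (other j).
Qed.

End Wheels.

(** * Prisms, pyramids and thetas as rungs *)

Section Families.
Variable G : sgraph.
Implicit Types (u v w z : G) (p q c s t : seq G) (L P : 'I_3 -> seq G).

Lemma cat_rev_edges_left p q u v : induced_cycle (p ++ rev q) -> q != [::] ->
  u \in p -> v \in p -> u -- v -> path_edge p u v.
Proof.
move=> ic q0; have {ic} ip : induced_path p.
  by apply: (induced_cycle_prefix ic); rewrite -size_eq0 size_rev size_eq0.
case: ip => U E /(nthP u)[i ilt <-] /(nthP u)[j jlt <-]; rewrite path_edge_nth //.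
case: (ltngtP i j) => [ij|ij|<-]; last by rewrite sedge_irr.
  by rewrite E ?ij // => ->.
by rewrite sedgeC E ?ij // orbC => ->.
Qed.

(** The cycle passes between [p] and [q] only in the middle of the list, where the two last entries
    meet, and at its closing edge, where the two heads meet. *)
Lemma cat_rev_edges_cross (x0 : G) p q u v : induced_cycle (p ++ rev q) ->
  u \in p -> v \in q -> u -- v ->
  (u = head x0 p /\ v = head x0 q) \/ (u = last x0 p /\ v = last x0 q).
Proof.
move=> /(induced_cycleP x0)[_ _ E] /(nthP x0)[i ilt <-] /(nthP x0)[j jlt <-].
have := E i (size p + (size q - j.+1)); rewrite !nth_cat ilt.
rewrite (_ : _ + _ < size p = false); last slia.
rewrite addKn nth_rev; last slia.
rewrite (_ : size q - (size q - j.+1).+1 = j); last slia.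
rewrite size_cat size_rev => -> //; last slia.
rewrite -!nth0 -!nth_last => /orP[/eqP e|/andP[/eqP e1 /eqP e2]].
  right; rewrite (_ : i = (size p).-1); last slia.
  by rewrite (_ : j = (size q).-1); last slia.
left; rewrite (_ : i = 0); last slia.
by rewrite (_ : j = 0); last slia.
Qed.

(** The triangle edges close [L i] and the reverse of [L j] to a cycle through all vertices of an
    induced cycle. So this listing is itself induced, and the adjacencies between the two paths can
    be read off. *)
Lemma prism_rungs (x y : 'I_3 -> G) L :
  prism_on x y L -> rungs x y L /\ ~~ (x i0 -- y i1).
Proof.
case=> -[tx ty dxy] pb dL cL.
have xy i j : x i != y j.
  apply: contraTneq dxy => E; apply/pred0Pn; exists (x i); rewrite /=.
  by rewrite imset_f // E imset_f.
have dL' i j v : i != j -> v \in L i -> v \notin L j.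
  move: i j; apply: forall_ord3_neq => [i j H vj|i j ij vi].
    by apply/negP=> /H; rewrite vj.
  by have := disjointFr (dL i j ij) (x := v); rewrite !inE => ->.
have ic i j : i != j -> induced_cycle (L i ++ rev (L j)).
  move: i j; apply: forall_ord3_neq => [i j|i j ij].
    by rewrite -(revK (L i)) -rev_cat revK => /induced_cycle_rev.
  have [c icc cE] := cL i j ij.
  have ij' : i != j by apply: contraTneq ij => ->; rewrite ltnn.
  apply: (hamiltonian_induced_cycle icc).
  - have U k : uniq (L k) by case/path_betweenP: (pb k) => s [->].
    rewrite cat_uniq rev_uniq !U andbT; apply/hasPn => v.
    by rewrite mem_rev => vj; apply: dL' vj; rewrite eq_sym.
  - have [s [-> ls _ ps]] := path_betweenP (pb i).
    have [t [-> lt _ pt]] := path_betweenP (path_between_rev (pb j)).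
    by rewrite /= rcons_cat cat_path ps ls /= rcons_path lt pt ty // sedgeC tx.
  by move=> v; have /setP/(_ v) := cE; rewrite !inE mem_cat mem_rev.
have hL' z i : head z (L i) = x i by have [s [-> *]] := path_betweenP (pb i).
have lL' z i : last z (L i) = y i.
  by have [s [-> ls *]] := path_betweenP (pb i); rewrite -ls.
have nL i : L i != [::] by have [s [-> *]] := path_betweenP (pb i).
have cross i j u v : i != j -> u \in L i -> v \in L j -> u -- v ->
   (u = x i /\ v = x j) \/ (u = y i /\ v = y j).
  move=> ij ui vj uv; have := cat_rev_edges_cross u (ic i j ij) ui vj uv.
  by rewrite !hL' !lL'.
have xL i : x i \in L i by have [s [-> *]] := path_betweenP (pb i); rewrite mem_head.
have yL i : y i \in L i by have [s [-> <- *]] := path_betweenP (pb i); rewrite mem_last.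
split; last first.
  apply/negP=> e; have : i0 != i1 by [].
  move/cross/(_ (xL _) (yL _) e); case=> -[].
    by move=> _ E; have := xy i1 i1; rewrite E eqxx.
  by move=> E; have := xy i0 i0; rewrite E eqxx.
split=> //; [by left|by left| |].
  by move=> i j v ij vi vj; have := dL' i j v ij vi; rewrite vj.
move=> i j u v ui vj uv; have [E|ij] := eqVneq i j.
  rewrite -E in vj; constructor 1; exists i.
  have [k /andP[ki _]] := third_ord3 i j.
  apply: (@cat_rev_edges_left _ (L k)) => //; apply: ic; by rewrite eq_sym.
case: (cross _ _ _ _ ij ui vj uv) => -[-> ->]; [constructor 2|constructor 3]; by exists i, j.
Qed.

(** As for prisms, with [w] omitted from the second path so that it is listed once. The bound on the
    number of single-edge paths supplies a [z k] not adjacent to [w]. *)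
Lemma pyramid_rungs w (z : 'I_3 -> G) P :
  pyramid_on w z P -> rungs (fun=> w) z P /\ exists k, ~~ (w -- z k).
Proof.
case=> tz pb PP len.
have PPI i j v : i != j -> v \in P i -> v \in P j -> v = w.
  move: i j; apply: forall_ord3_neq => [i j H vj vi|i j ij vi vj]; first exact: H.
  by apply/set1P; rewrite -(PP i j ij).1 !inE vi vj.
have PPc i j : i != j -> exists2 c, induced_cycle c & forall v, (v \in c) = (v \in P i) || (v \in P j).
  move: i j; apply: forall_ord3_neq => [i j [c ic E]|i j ij].
    by exists c => // v; rewrite E orbC.
  have [_ [c ic E]] := PP i j ij; exists c => // v.
  by have /setP/(_ v) := E; rewrite !inE.
have Pw i : P i = w :: behead (P i) by have [s [-> *]] := path_betweenP (pb i).
have [wP zP] : (forall i, w \in P i) /\ (forall i, z i \in P i).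
  split=> i; have [s [-> ls *]] := path_betweenP (pb i); first exact: mem_head.
  by rewrite -ls mem_last.
have ic0 i j : i != j -> z j != w -> induced_cycle (P i ++ rev (behead (P j))).
  move=> ij zjw; have [c icc cE] := PPc i j ij.
  have [s [Pi ls Us ps]] := path_betweenP (pb i).
  have [t [Pj lt Ut pt]] := path_betweenP (pb j).
  have [//|t0] := eqVneq t [::]; first by move=> E; rewrite E /= in lt; rewrite lt eqxx in zjw.
  apply: (hamiltonian_induced_cycle icc).
  - have Ui : uniq (P i) by rewrite Pi.
    move: Ut; rewrite cons_uniq => /andP[wt Ut].
    rewrite cat_uniq Ui rev_uniq Pj [behead _]/= Ut andbT; apply/hasPn=> v; rewrite mem_rev => vt; apply/negP=> vi.
    have E : v = w by apply: (PPI i j) => //; rewrite ?Pi // Pj in_cons vt orbT.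
    by rewrite -E vt in wt.
  - rewrite Pi Pj /= rcons_cat cat_path ps ls /=.
    have := path_between_rev (pb j); rewrite Pj lastI lt rev_rcons.
    case/lastP: t t0 {Pj pt} Ut lt => // t b _ _; rewrite last_rcons => ->.
    rewrite belast_rcons => /path_betweenP[r [[<-]]]; rewrite rev_cons rev_rcons /=.
    by move=> _ _ ->; rewrite tz.
  by move=> v; rewrite cE Pj mem_cat mem_rev in_cons Pi in_cons; case: (v == w); rewrite ?orbT.
(* If [z j] were [w], path [j] would be the single vertex [w], and [w] would be adjacent to [z i],
   making path [i] a single edge; two vertices do not carry a cycle. *)
have zw j : z j != w.
  apply/eqP=> zj; have [i [ij]] : exists i, i != j /\ True.
    by have [k /andP[kj _]] := third_ord3 j j; exists k.
  move=> _; have [k /andP[ki kj]] := third_ord3 i j.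
  have zn l : l != j -> w -- z l by move=> lj; rewrite -zj sedgeC tz.
  have zkw : z k != w by apply: contraTneq (zn k kj) => ->; rewrite sedge_irr.
  have icc := ic0 i k (_ : i != k) zkw; rewrite eq_sym in ki; have {icc}icc := icc ki.
  have [s [Pi ls Us ps]] := path_betweenP (pb i).
  have [t [Pk lt Ut pt]] := path_betweenP (pb k).
  have t0 : behead (P k) != [::].
    by rewrite Pk /=; apply: contraNneq zkw => E; rewrite -lt E.
  have e := cat_rev_edges_left icc t0 (wP i) (zP i) (zn i ij).
  have sz : size (P i) = 2.
    have U : uniq (P i) by rewrite Pi.
    by have := path_edge_index U e; rewrite Pi -ls index_last // /= eqxx => -[->|].
  have [c [c2 U _] cE] := PPc i j ij; suff: {subset c <= P i}.
    by move/(uniq_leq_size U); rewrite sz leqNgt c2.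
  move=> v; rewrite cE => /orP[//|vj].
  suff -> : v = w by [].
  have [r [Pj lr Ur pr]] := path_betweenP (pb j).
  case: r Pj lr Ur pr => [|b r] Pj lr Ur pr; first by move: vj; rewrite Pj inE => /eqP.
 
  by move: Ur => /=; rewrite -{1}zj -{1}lr /= mem_last.
have ic i j ij := ic0 i j ij (zw j).
have bN i : behead (P i) != [::].
  have [s [-> ls _ _]] := path_betweenP (pb i); apply: contraNneq (zw i) => /= s0.
  by rewrite -ls s0.
have same i u v : u \in P i -> v \in P i -> u -- v -> path_edge (P i) u v.
  have [k /andP[ki _]] := third_ord3 i i => ui vi uv.
  by apply: (cat_rev_edges_left (ic i k _) (bN k)); rewrite // eq_sym.
split; last first.
  have [i ni] : exists i, path_length (P i) != 1.
    apply: NNPP => nn; have all1 i : i \in [set i : 'I_3 | path_length (P i) == 1].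
      by rewrite inE; apply/negPn/negP=> h; apply: nn; exists i.
    by have := card_le1_eqP len _ _ (all1 i0) (all1 i1).
  exists i; apply: contra ni => /(same i _ _ (wP i) (zP i)) e.
  have [s [Pi ls Us ps]] := path_betweenP (pb i).
  have U : uniq (P i) by rewrite Pi.
  by have := path_edge_index U e; rewrite /path_length Pi -ls index_last // /= eqxx => -[->|//].
split=> //.
- by right.
- by left.
- by move=> _ j; rewrite eq_sym.
- by move=> i j v ij vi vj; left=> _; exact: PPI vi vj.
move=> i j u v ui vj uv; have [E|ij] := eqVneq i j.
  by rewrite -E in vj; constructor 1; exists i; exact: same.
have := vj; rewrite Pw in_cons => /orP[/eqP E|vb].
  by constructor 1; exists i; apply: same => //; rewrite E.
case: (cat_rev_edges_cross w (ic i j ij) ui vb uv) => -[eu ev].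
  constructor 1; exists j; apply: same => //.
  by rewrite eu Pw.
constructor 3; exists i, j; move: eu ev.
have [s [-> <- _ _]] := path_betweenP (pb i).
by have := bN j; have [[|b t] [-> <- _ _]] := path_betweenP (pb j).
Qed.

(* In a cycle that is the union of two paths, an inner vertex of one path has
   both its neighbours on that path; so once the two paths have left [x] in
   different directions, they only meet again in [y]. *)
Lemma theta_paths_disjoint x y p q v :
  x != y -> ~~ (x -- y) -> path_between x y p -> path_between x y q ->
  induces_cycle (path_vertices p :|: path_vertices q) ->
  v \in p -> v \in q -> v = x \/ v = y.
Proof.
move=> xy nxy pp pq [c ic cE].
have {}cE u : (u \in c) = (u \in p) || (u \in q).
  by have /setP/(_ u) := cE; rewrite !inE.
have nb r i : path_between x y r -> i.+1 < size r -> nth x r i -- nth x r i.+1.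
  by case/path_betweenP=> s [-> _ _ ps] ir; apply: (sortedP x (ps : sorted _ (_ :: _))).
have inner r i u : path_between x y r -> {subset r <= c} -> 0 < i -> i.+1 < size r ->
    u \in c -> nth x r i -- u -> u = nth x r i.-1 \/ u = nth x r i.+1.
  move=> pr rc i_gt0 ir uc e.
  have e1 : nth x r i -- nth x r i.-1.
    by rewrite sedgeC; have := nb r i.-1 pr; rewrite prednK //; apply; exact: ltnW.
  have Ur : uniq r by case/path_betweenP: pr => s [->].
  have mr k : k < size r -> nth x r k \in c by move=> kr; apply/rc/mem_nth.
  have i1r : i.-1 < size r by slia.
  have := induced_cycle_degree ic (mr i (ltnW ir)) (mr _ i1r) (mr _ ir) uc e1 (nb r i pr ir) e.
  rewrite nth_uniq //; case/or3P=> [|/eqP->|/eqP->]; [slia|by left|by right].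
have posI r u : path_between x y r -> u \in r -> u != x -> u != y ->
    exists i, [/\ 0 < i, i.+1 < size r & u = nth x r i].
  case/path_betweenP=> s [-> ls _ _] /(nthP x)[i ir <-] ux uy; exists i.
  have i_gt0 : 0 < i by case: i ir ux uy => //=; rewrite eqxx.
  split=> //; rewrite ltn_neqAle ir andbT; apply: contraNneq uy => E.
  by case: E => ->; rewrite -ls -[last x s]/(last x (x :: s)) -nth_last.
have sz r : path_between x y r -> 2 < size r.
  case/path_betweenP=> [[|a [|b s]]] [-> ls _ ps] //; first by rewrite -ls eqxx in xy.
  by move: ps nxy => /=; rewrite -ls /= andbT => ->.
have xE r : path_between x y r -> nth x r 0 = x by case/path_betweenP=> s [->].
have first r u : path_between x y r -> {subset r <= c} -> u \in r -> x -- u -> u = nth x r 1.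
  move=> pr rc ur xu; have Ur : uniq r by case/path_betweenP: pr => s [->].
  have ux : u != x by rewrite eq_sym sedge_neq.
  have uy : u != y by apply: contraNneq nxy => <-.
  have [i [i_gt0 ir E]] := posI r u pr ur ux uy; rewrite {}E sedgeC in xu *.
  have r_gt0 : 0 < size r by slia.
  have := inner r i (nth x r 0) pr rc i_gt0 ir (rc _ (mem_nth x r_gt0)).
  rewrite -[X in _ -- X](xE r pr) in xu => /(_ xu) [/eqP|/eqP]; rewrite nth_uniq //; try slia.
  by move/eqP=> i1; rewrite (_ : i = 1) //; slia.
have pc : {subset p <= c} by move=> u up; rewrite cE up.
have qc : {subset q <= c} by move=> u uq; rewrite cE uq orbT.
have [c2 Uc ec] := ic.
have xc : x \in c by rewrite -(xE p) // pc // mem_nth // ltnW // ltnW // sz.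
have p1q1 : nth x p 1 != nth x q 1.
  apply/eqP=> E.
  have nx u : u \in c -> x -- u -> u = nth x p 1.
    by rewrite cE => /orP[up|uq] xu; [apply: first xu|rewrite E; apply: first xu].
  have := next_neq_prev Uc c2 xc.
  rewrite (nx (next c x)) ?mem_next //; last by rewrite ec ?mem_next ?eqxx.
  rewrite (nx (prev c x)) ?mem_prev ?eqxx // ec ?mem_prev //.
  by rewrite next_prev // eqxx orbT.
(* Induction along [q]: an inner vertex of [q] lying on [p] would be an inner vertex of [p], so its
   predecessor on [q] would lie on [p] too. The induction starts because the two paths leave [x]
   differently. *)
have q_notin_p k : 0 < k -> k.+1 < size q -> nth x q k \notin p.
  elim: k => // -[_ _ q2|k IH _ kq]; apply/negP=> qp.
    case/eqP: p1q1; apply/esym/first => //; rewrite -{1}(xE q) //; apply: nb => //.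
    exact: ltnW.
  have Uq : uniq q by case/path_betweenP: pq => s [->].
  have qx : nth x q k.+2 != x.
    by rewrite -[X in _ != X](xE q) // nth_uniq //; slia.
  have qy : nth x q k.+2 != y.
    case/path_betweenP: pq kq Uq => s [-> <- _ _] kq Uq.
    by rewrite -[last x s]/(last x (x :: s)) -nth_last nth_uniq //; slia.
  have [i [i_gt0 ip E]] := posI p _ pp qp qx qy.
  have := inner p i (nth x q k.+1) pp pc i_gt0 ip; rewrite -E sedgeC.
  have k1q : k.+1 < size q by slia.
  move/(_ (qc _ (mem_nth x k1q)) (nb q k.+1 pq (ltnW kq))).
  have := IH isT (ltnW kq).
  by move=> /negP np [] F; apply: np; rewrite F mem_nth //; slia.
move=> vp vq; have [->|vx] := eqVneq v x; first by left.
have [->|vy] := eqVneq v y; first by right.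
have [i [i_gt0 iq E]] := posI q v pq vq vx vy.
by have := q_notin_p i i_gt0 iq; rewrite -E vp.
Qed.

Lemma theta_rungs x y P :
  theta_on x y P -> rungs (fun=> x) (fun=> y) P /\ ~~ (x -- y).
Proof.
case=> xy nxy pb PP; split=> //.
have PPe i j u v : i != j -> u \in P i -> v \in P i \/ v \in P j -> u -- v ->
    path_edge (P i) u v || path_edge (P j) u v.
  have half (k l : 'I_3) : k < l -> {in [predU P k & P l] &, forall a b, a -- b ->
      path_edge (P k) a b || path_edge (P l) a b}.
    move=> kl a b ak bk; have [_ E] := PP k l kl.
    by rewrite E // !inE.
  move=> ij ui vij uv; case: (ltngtP i j) => [lt|lt|/val_inj E].
  - apply: (half i j lt) => //; rewrite !inE ?ui //.
    by case: vij => ->; rewrite ?orbT.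
  - rewrite orbC; apply: (half j i lt) => //; rewrite !inE ?ui ?orbT //.
    by case: vij => ->; rewrite ?orbT.
  by rewrite E eqxx in ij.
split=> //; [by right|by right| |].
  move=> i j v ij vi vj.
  suff: v = x \/ v = y by case=> ->; [left|right].
  have : v \in P i -> v \in P j -> v = x \/ v = y; last exact.
  move: i j ij {vi vj}; apply: forall_ord3_neq => [i j H vj vi|i j ij]; first exact: H.
  by apply: theta_paths_disjoint => //; have [] := PP i j ij.
move=> i j u v ui vj uv; constructor 1; have [E|ij] := eqVneq i j.
  have [k /andP[ki _]] := third_ord3 i j; rewrite eq_sym in ki.
  rewrite -E in vj; have := PPe i k u v ki ui (or_introl vj) uv.
  by case/orP; [exists i|exists k].
by case/orP: (PPe i j u v ij ui (or_intror vj) uv); [exists i|exists j].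
Qed.

End Families.

(** * A hole with a path attached to it *)

Section Holes.
Variable G : sgraph.
Implicit Types (x y u v w z : G) (p q c s t : seq G) (L P : 'I_3 -> seq G).

Lemma induced_cycle_nth x0 c i j : induced_cycle c -> i < size c -> j < size c ->
  (nth x0 c i -- nth x0 c j) =
  [|| j == i.+1, i == j.+1, (i == 0) && (j == (size c).-1)
    | (j == 0) && (i == (size c).-1)].
Proof.
case/(induced_cycleP x0) => c2 U E ic jc.
case: (ltngtP i j) => [ij|ij|<-].
- rewrite E ?ij //; slia.
- rewrite sedgeC E ?ij //; slia.
rewrite sedge_irr; slia.
Qed.

Lemma induced_cycle_size_ge4 c u v : induced_cycle c -> u \in c -> v \in c ->
  u != v -> ~~ (u -- v) -> 4 <= size c.
Proof.
move=> ic /(nthP u)[i ilt <-] /(nthP u)[j jlt <-]; have [c2 U _] := ic.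
rewrite nth_uniq // induced_cycle_nth //; slia.
Qed.

Lemma induced_cycle_triangle_free c u v w : induced_cycle c -> 4 <= size c ->
  u \in c -> v \in c -> w \in c -> u -- v -> v -- w -> u -- w -> False.
Proof.
move=> ic c4 /(nthP u)[i ilt <-] /(nthP u)[j jlt <-] /(nthP u)[k klt <-].
rewrite !induced_cycle_nth //; slia.
Qed.

Lemma rotate_to_vertex c u : induced_cycle c -> u \in c ->
  exists t, induced_cycle (u :: t) /\ u :: t =i c.
Proof.
move=> ic /rot_to[n t E]; exists t; rewrite -E; split; last exact: mem_rot.
exact/induced_cycle_rot.
Qed.

(** When the cycle is listed from [u], its neighbour [u'] is second or last; in the former case the
    cycle is listed backwards. *)
Lemma rotate_to_edge c u u' : induced_cycle c -> u \in c -> u' \in c -> u -- u' ->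
  exists t, induced_cycle (u :: rcons t u') /\ u :: rcons t u' =i c.
Proof.
move=> ic uc uc' uu'; have [t [it tE]] := rotate_to_vertex ic uc.
have : u' \in u :: t by rewrite tE.
case/(nthP u)=> i; case: t it tE => [|b t] it tE ilt E; first by case: it.
have := induced_cycle_nth u it (isT : 0 < size [:: u, b & t]) ilt; rewrite E uu' => /esym.
have [i1 _|i1] := eqVneq i 1; last first.
  rewrite /= => h; have {}h : i = (size t).+1.
    move: h ilt i1 => /= h ilt i1; have : i != 0 by apply: contraTneq uu' => i0; rewrite -E i0 sedge_irr.
    slia.
  case/lastP: t h it tE ilt E => [|t d] h it tE _ E.
    by rewrite h in i1.
  move: E; rewrite h size_rcons /= nth_rcons ltnn eqxx => <-.
  by exists (b :: t).
rewrite i1 /= in E; rewrite -E; exists (rev t); split; last first.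
  by move=> h; rewrite -tE !(inE, mem_rcons, mem_rev).
by apply/(induced_cycle_rot 1); rewrite rot1_cons -rev_cons -rev_cons; apply/induced_cycle_rev.
Qed.

Lemma induced_cycle_suffix s t : induced_cycle (s ++ t) -> s != [::] -> induced_path t.
Proof.
move=> ic s0; rewrite -(revK t); apply: induced_path_rev.
apply: (@induced_cycle_prefix _ _ (rev s)).
  by rewrite -rev_cat; apply/induced_cycle_rev.
by rewrite -size_eq0 size_rev size_eq0.
Qed.

End Holes.

Section Attachment.
Variable G : sgraph.
Implicit Types (x y w z h k : G) (q s t : seq G) (L P : 'I_3 -> seq G).

(* [u = u'] is allowed and means that [a] has a single neighbour on [c];
   likewise for [v], [v'] and [b]. *)
Record attached (c p : seq G) (a b u u' v v' : G) : Prop := Attached {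
  att_cycle : induced_cycle c;
  att_path : induced_path p;
  att_ends : path_between a b p;
  att_out : {in p, forall k, k \notin c};
  att_size : 1 < size p;
  att_u : u \in c; att_u' : u' \in c; att_v : v \in c; att_v' : v' \in c;
  att_uv : u != v; att_uv' : u != v'; att_u'v : u' != v; att_u'v' : u' != v';
  att_edge : {in c & p, forall h k, (h -- k) =
    (k == a) && ((h == u) || (h == u')) || (k == b) && ((h == v) || (h == v'))} }.

Lemma attached_rev c p a b u u' v v' :
  attached c p a b u u' v v' -> attached c (rev p) b a v v' u u'.
Proof.
case=> ic ip pb out sz uc uc' vc vc' n1 n2 n3 n4 E; split=> //; rewrite 1?eq_sym //.
- exact: induced_path_rev.
- exact: path_between_rev.
- by move=> k; rewrite mem_rev; apply: out.
- by rewrite size_rev.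
- by move=> h k hc; rewrite mem_rev => kp; rewrite E // orbC.
Qed.

Lemma attached_swap c p a b u u' v v' :
  attached c p a b u u' v v' -> attached c p a b u u' v' v.
Proof.
case=> ic ip pb out sz uc uc' vc vc' n1 n2 n3 n4 E; split=> // h k hc kp.
by rewrite E // (orbC (h == v)).
Qed.

(** On the arc, [a] is attached only to [x] and [b] only to [y], so the arc and [p] are joined by
    exactly two edges, head to head and last to last. *)
Lemma attached_arc c p a b u u' v v' x y s :
  attached c p a b u u' v v' ->
  induced_path s -> path_between x y s -> {subset s <= c} ->
  {in s, forall h, (h == u) || (h == u') = (h == x)} ->
  {in s, forall h, (h == v) || (h == v') = (h == y)} ->
  induced_cycle (s ++ rev p).
Proof.
case=> ic ip pb out sz _ _ _ _ _ _ _ _ E is_ sb sc sx sy.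
have [s' [sE ls _ _]] := path_betweenP sb; have [p' [pE lp _ _]] := path_betweenP pb.
apply: (cat_rev_induced_cycle (x0 := x)) => //.
- by rewrite sE.
- by rewrite pE.
- by rewrite sE pE; move: sz; rewrite pE /=; slia.
- by move=> h /sc hc; apply: contraL hc => /out.
move=> h k hs kp; rewrite E ?sx ?sy //; last exact: sc.
by rewrite sE pE /= ls lp andbC [in RHS]andbC (andbC (k == b)) (andbC (k == a)).
Qed.

(** Each of the two paths is an arc of the cycle. An edge from one arc to the interior of the other
    starts at [x] or [y] and leads to the first or last inner vertex of the other path, so it is an
    edge of that path. *)
Lemma union_cycle x y s t : s != [::] -> t != [::] ->
  induced_cycle (x :: s ++ y :: rev t) ->
  union_induced_cycle (x :: rcons s y) (x :: rcons t y).
Proof.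
move=> s0 t0 ic.
have ic1 : induced_cycle ((x :: rcons s y) ++ rev t) by rewrite /= cat_rcons.
have ic2 : induced_cycle ((x :: rcons t y) ++ rev s).
  rewrite /= cat_rcons -(induced_cycle_rot 1) rot1_cons -induced_cycle_rev.
  by rewrite rev_rcons rev_cat rev_cons revK cat_rcons.
have so : sorted (@sedge G) (x :: rcons s y) /\ sorted (@sedge G) (x :: rcons t y).
  by split; [have := induced_cycle_sedge ic1|have := induced_cycle_sedge ic2];
     rewrite /= rcons_cat cat_path => /andP[].
split.
  exists ((x :: rcons s y) ++ rev t) => //; apply/setP=> h.
  rewrite !inE mem_cat mem_rev !(inE, mem_rcons).
  by case: (h == x); case: (h == y); case: (h \in s).
have X r : r != [::] -> path_edge (x :: rcons r y) x (head x r) /\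
    path_edge (x :: rcons r y) y (last x r).
  case: r => // d r _; split; first by rewrite /path_edge /= in_cons eqxx.
  rewrite path_edgeC /path_edge; apply/orP; left; apply/(zip_beheadP x).
  exists (size r).+1; rewrite /= !size_rcons; split=> //.
    rewrite -rcons_cons nth_rcons /= ltnS leqnn -[size r]/(size (d :: r)).-1.
    by rewrite (nth_last x (d :: r)).
  by rewrite nth_rcons ltnn eqxx.
have half h k r r' : induced_cycle ((x :: rcons r y) ++ rev r') -> r' != [::] ->
    h \in x :: rcons r y -> (k \in x :: rcons r y) || (k \in r') -> h -- k ->
    path_edge (x :: rcons r y) h k || path_edge (x :: rcons r' y) h k.
  move=> icr r0 hr /orP[kr|kr] hk.
    by rewrite (cat_rev_edges_left icr r0 hr kr hk).
  have [X1 X2] := X _ r0.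
  case: (cat_rev_edges_cross x icr hr kr hk) => -[-> ->] /=.
    by rewrite X1 orbT.
  by rewrite last_rcons X2 orbT.
move=> h k; rewrite !in_setU !inE => hS kS; apply/idP/idP=> [hk|]; last first.
  by case/orP; apply: path_edge_sedge; case: so.
have split_mem g : [|| g == x | g \in rcons s y] || [|| g == x | g \in rcons t y] ->
    (g \in x :: rcons s y) || (g \in t) /\ ((g \in x :: rcons t y) || (g \in s)).
  rewrite !(inE, mem_rcons).
  by case: (g == x); case: (g == y); case: (g \in s); case: (g \in t).
have [h1 h2] := split_mem h hS; have [k1 k2] := split_mem k kS.
case/orP: h1 => h1; first exact: half h1 k1 hk.
rewrite orbC; apply: half k2 hk => //.
by rewrite in_cons mem_rcons in_cons h1 !orbT.
Qed.

Lemma induced_cycle_mirror x y s t :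
  induced_cycle (x :: s ++ y :: t) -> induced_cycle (x :: rev t ++ y :: rev s).
Proof.
move=> ic; apply/(induced_cycle_rot 1); rewrite rot1_cons; apply/induced_cycle_rev.
by rewrite rev_rcons rev_cat rev_cons !revK cat_rcons.
Qed.

Lemma induced_cycle_arc x y s t :
  induced_cycle (x :: s ++ y :: t) ->
  path_between x y (x :: rcons s y) /\ (t != [::] -> induced_path (x :: rcons s y)).
Proof.
rewrite -cat_rcons => ic; split; last by rewrite -cat_cons in ic; exact: induced_cycle_prefix ic.
have [_ U _] := ic; have := induced_cycle_sedge ic; rewrite /= rcons_cat cat_path.
case/andP=> ps _; rewrite /path_between /= eqxx last_rcons eqxx ps andbT /=.
by move: U; rewrite -cat_cons cat_uniq => /andP[].
Qed.

Lemma induces_cycle_union c p q : induced_cycle c ->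
  (forall h, (h \in c) = (h \in p) || (h \in q)) ->
  induces_cycle (path_vertices p :|: path_vertices q).
Proof. by move=> ic E; exists c => //; apply/setP=> h; rewrite !inE E. Qed.

(** The paths between [u] and [v] are the two arcs of [c] and [p] extended by [u] and [v]. Since [u]
    and [v] are not adjacent, neither arc is a single edge. *)
Lemma theta_config c p a b u v : attached c p a b u u v v -> ~~ (u -- v) ->
  exists x y P, theta_on x y P.
Proof.
move=> att nuv; have uv := att_uv att.
have [t [it tE]] := rotate_to_vertex (att_cycle att) (att_u att).
have : v \in t by have := att_v att; rewrite -tE in_cons eq_sym (negbTE uv).
move=> vt; case/splitPr: t / vt => s t in it tE *.
have it2 := induced_cycle_mirror it.
have nz r r' : induced_cycle (u :: r ++ v :: r') -> r != [::].
  move=> ir; apply: contraNneq nuv => r0.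
  by have := induced_cycle_sedge ir; rewrite r0 /= => /andP[].
have s0 := nz _ _ it; have t0 := nz _ _ it2.
have t0' : t != [::] by apply: contraNneq t0 => ->.
have s0' : rev s != [::] by apply: contraNneq s0 => /(congr1 rev); rewrite revK => ->.
have p0 : p != [::] by have := att_size att; case: (p).
have arc r r' : induced_cycle (u :: r ++ v :: r') -> r' != [::] ->
    u :: r ++ v :: r' =i c -> induced_cycle (u :: r ++ v :: rev p).
  move=> ir r0 E; have [pb ip] := induced_cycle_arc ir.
  rewrite -cat_rcons -cat_cons; apply: (attached_arc att (ip r0) pb).
  - by move=> h hr; rewrite -E -cat_rcons -cat_cons mem_cat hr.
  - by move=> h _; rewrite orbb.
  by move=> h _; rewrite orbb.
have it2E : u :: rev t ++ v :: rev s =i c.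
  move=> h; rewrite -tE !(inE, mem_cat, mem_rev).
  by case: (h == u) (h == v) (h \in s) (h \in t) => [] [] [] [].
have i02 := arc _ _ it t0' tE; have i12 := arc _ _ it2 s0' it2E.
exists u, v, (tuple3 (u :: rcons s v) (u :: rcons (rev t) v) (u :: rcons p v)); split=> //.
  apply: forall_ord3; rewrite /tuple3 /=.
  - by have [] := induced_cycle_arc it.
  - by have [] := induced_cycle_arc it2.
  have := induced_cycle_mirror i02; rewrite revK => i20.
  by have [] := induced_cycle_arc i20.
set P := tuple3 _ _ _.
apply: (@forall_ord3_lt (fun i j => union_induced_cycle (P i) (P j))); rewrite /P /tuple3 /=.
- by apply: union_cycle => //; rewrite revK.
- exact: union_cycle.
exact: union_cycle.
Qed.

(** The apex is [v] and the triangle is [u], [u'], [a]; the paths are the arcs of [c] from [v] to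
    [u] and to [u'], and [v] followed by [p] traversed from [b] to [a]. *)
Lemma pyramid_config c p a b u u' v : attached c p a b u u' v v ->
  u -- u' -> ~~ (u -- v) -> exists w (z : 'I_3 -> G) P, pyramid_on w z P.
Proof.
move=> att uu' nuv; have uv := att_uv att; have u'v := att_u'v att.
have [t [it tE]] := rotate_to_edge (att_cycle att) (att_u att) (att_u' att) uu'.
have vt : v \in t.
  have := att_v att; rewrite -tE in_cons mem_rcons in_cons.
  by rewrite !(eq_sym v) (negbTE uv) (negbTE u'v).
case/splitPr: t / vt => s t in it tE *; rewrite rcons_cat rcons_cons in it tE.
have it' : induced_cycle (v :: t ++ u' :: u :: s).
  have := (induced_cycle_rot (size (u :: s)) _).2 it.
  by rewrite -cat_cons rot_size_cat /= cat_rcons.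
have [pb0 ip0] := induced_cycle_arc it; have [pb1 /(_ isT) ip1] := induced_cycle_arc it'.
have {}ip0 := ip0 (_ : rcons t u' != [::]).
have {}ip0 : induced_path (u :: rcons s v) by apply: ip0; case: (t).
have s0 : s != [::].
  apply: contraNneq nuv => s0; move: pb0; rewrite s0 => /path_betweenP[r [[<-]]] /=.
  by move=> _ _ /andP[].
have [_ U _] := it.
have Us : uniq ((u :: rcons s v) ++ rcons t u') by rewrite /= cat_rcons.
have Ud h : h \in u :: rcons s v -> h \notin rcons t u'.
  by move: Us; rewrite cat_uniq => /and3P[_ /hasPn H _] hs; apply/negP=> /H; rewrite hs.
have Uv h : h \in v :: rcons t u' -> h \notin u :: s.
  by move: U; rewrite -cat_cons cat_uniq => /and3P[_ /hasPn H _] /H.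
have cs h : h \in u :: rcons s v -> h \in c.
  by rewrite -tE -cat_rcons -cat_cons mem_cat => ->.
have ct h : h \in v :: rcons t u' -> h \in c.
  by rewrite -tE -cat_cons mem_cat => ->; rewrite orbT.
have i02 : induced_cycle ((u :: rcons s v) ++ rev p).
  apply: (attached_arc att ip0 pb0 cs) => h hs; last by rewrite orbb.
  case: (h =P u') => [E|_]; last by rewrite orbF.
  by have := Ud h hs; rewrite E mem_rcons mem_head.
have i12 : induced_cycle (rev (v :: rcons t u') ++ rev p).
  apply: (attached_arc att (induced_path_rev ip1) (path_between_rev pb1)) => h; rewrite mem_rev.
  - exact: ct.
  - move=> ht; case: (h =P u) => [E|_] //.
    by have := Uv h ht; rewrite E mem_head.
  by rewrite orbb.
have [p' [pE lp Up pp]] := path_betweenP (att_ends att).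
have ap : a \in p by rewrite pE mem_head.
have bp : b \in p by rewrite pE -lp mem_last.
have ua : u -- a by rewrite (att_edge att (att_u att) ap) !eqxx.
have u'a : u' -- a by rewrite (att_edge att (att_u' att) ap) !eqxx /= orbT.
have vb : v -- b by rewrite (att_edge att (att_v att) bp) !eqxx /= orbT.
have vp : v \notin p by apply: contraL (att_v att) => /(att_out att).
have vA : v \in u :: rcons s v by rewrite in_cons mem_rcons mem_head orbT.
have vB : v \in v :: rcons t u' by rewrite mem_head.
have vC : v \in rcons p v by rewrite mem_rcons mem_head.
have pv h : h != v -> (h \in rcons p v) = (h \in p).
  by rewrite mem_rcons in_cons => /negbTE->.
pose P := tuple3 (rev (u :: rcons s v)) (v :: rcons t u') (rev (rcons p v)).
exists v, (tuple3 u u' a), P; split.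
- move=> i j; move: i j; apply: forall_ord3_neq => [i j|]; first by rewrite sedgeC.
  exact: (@forall_ord3_lt (fun i j => tuple3 u u' a i -- tuple3 u u' a j)).
- apply: forall_ord3; rewrite /P /tuple3 /=; [exact: path_between_rev|exact: pb1|].
  apply: path_between_rev; rewrite /path_between last_rcons eqxx rcons_uniq vp /=.
  by rewrite pE Up /= rcons_path pp lp eqxx sedgeC vb.
- apply: (@forall_ord3_lt (fun i j => path_vertices (P i) :&: path_vertices (P j) = [set v]
    /\ induces_cycle (path_vertices (P i) :|: path_vertices (P j)))); rewrite /P /tuple3 /=.
  + split.
      apply/setP=> h; rewrite in_set1 in_setI !in_set mem_rev; case: (eqVneq h v) => [->|hv].
        by rewrite vA vB.
      apply/negP=> /andP[/Ud hA]; rewrite in_cons (negbTE hv) /=; exact/negP.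
    apply: (induces_cycle_union it) => h; rewrite mem_rev -cat_cons mem_cat.
    case: (eqVneq h v) => [->|hv]; first by rewrite vA vB orbT.
    by congr orb; rewrite !in_cons mem_rcons in_cons (negbTE hv).
  + split.
      apply/setP=> h; rewrite in_set1 in_setI !in_set !mem_rev; case: (eqVneq h v) => [->|hv].
        by rewrite vA vC.
      by rewrite pv //; apply/negP=> /andP[/cs hc /(att_out att)]; rewrite hc.
    apply: (induces_cycle_union i02) => h; rewrite mem_cat !mem_rev.
    by case: (eqVneq h v) => [->|hv]; [rewrite vA|rewrite pv].
  split.
    apply/setP=> h; rewrite in_set1 in_setI !in_set !mem_rev; case: (eqVneq h v) => [->|hv].
      by rewrite vB vC.
    by rewrite pv //; apply/negP=> /andP[/ct hc /(att_out att)]; rewrite hc.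
  apply: (induces_cycle_union i12) => h; rewrite mem_cat !mem_rev.
  by case: (eqVneq h v) => [->|hv]; [rewrite vB|rewrite pv].
(* Only the path from [v] to [u'] can be a single edge: [v] is not adjacent to [u], and [p] has at
   least two vertices. *)
apply: leq_trans (_ : #|[set i1]| <= 1); last by rewrite cards1.
apply/subset_leq_card/subsetP => i; rewrite !inE; move: i; apply: forall_ord3;
  rewrite /P /tuple3 /path_length ?size_rev /= ?size_rev /= ?size_rcons //=.
  by rewrite eqSS size_eq0 (negbTE s0).
by have := att_size att; case: (size p) => [|[]].
Qed.

(** The triangles are [u], [u'], [a] and [v], [v'], [b]. Deleting the edges [u u'] and [v v'] from
    [c] leaves two arcs, which together with [p] are the three paths. *)
Lemma prism_config c p a b u u' v v' : attached c p a b u u' v v' ->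
  u -- u' -> v -- v' -> exists (x y : 'I_3 -> G) L, prism_on x y L.
Proof.
move=> att0 uu' vv'.
have [t [it tE]] := rotate_to_edge (att_cycle att0) (att_u att0) (att_u' att0) uu'.
have inT h : h \in c -> u != h -> u' != h -> h \in t.
  rewrite -tE in_cons mem_rcons in_cons !(eq_sym h) => hc.
  by move: hc => + /negbTE uh /negbTE u'h; rewrite uh u'h.
(* [v] and [v'] are consecutive on the rest of [c]; after exchanging them if necessary, one arc goes
   from [u] to [v] and the other from [v'] to [u']. *)
wlog [s [t' Et]] : v v' att0 vv' / exists s t', t = s ++ v :: v' :: t'.
  have idx : exists i j, [/\ i < size t, j < size t, v = nth u t i, v' = nth u t j &
      j = i.+1 \/ i = j.+1].
    have /(nthP u)[i ilt iE] := inT v (att_v att0) (att_uv att0) (att_u'v att0).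
    have /(nthP u)[j jlt jE] := inT v' (att_v' att0) (att_uv' att0) (att_u'v' att0).
    exists i, j; split=> //.
    have := @induced_cycle_nth _ u (u :: rcons t u') i.+1 j.+1 it.
    rewrite /= !nth_rcons ilt jlt iE jE vv' size_rcons !ltnS => /(_ (leqW ilt) (leqW jlt)).
    by move=> h; slia.
  have cut i : i.+1 < size t -> t = take i t ++ nth u t i :: nth u t i.+1 :: drop i.+2 t.
    by move=> lt; rewrite -!drop_nth ?cat_take_drop // ltnW.
  case: idx => i [j [ilt jlt -> -> E]] in vv' att0 * => H.
  case: E => E; rewrite E in jlt ilt att0 vv' *.
    by apply: (H _ _ att0 vv'); exists (take i t), (drop i.+2 t); exact: cut.
  rewrite sedgeC in vv'; apply: (H _ _ (attached_swap att0) vv'); exists (take j t), (drop j.+2 t); exact: cut.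
clear inT; rewrite {}Et rcons_cat !rcons_cons in it tE; rename att0 into att.
have it' : induced_cycle (v' :: t' ++ u' :: u :: rcons s v).
  have := (induced_cycle_rot (size (u :: rcons s v)) _).2 it.
  by rewrite -(cat_rcons v) -cat_cons rot_size_cat /= cat_rcons.
have [pb0 /(_ isT) ip0] := induced_cycle_arc it.
have [pb1 /(_ isT) ip1] := induced_cycle_arc it'.
have Ud h : h \in u :: rcons s v -> h \notin v' :: rcons t' u'.
  have [_] := it; rewrite -cat_rcons -cat_cons cat_uniq => /and3P[_ /hasPn H _] _ hs.
  by apply/negP=> /H; rewrite hs.
have cE h : (h \in c) = (h \in u :: rcons s v) || (h \in v' :: rcons t' u').
  by rewrite -tE -cat_rcons -cat_cons mem_cat.
have uA : u \in u :: rcons s v by exact: mem_head.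
have vA : v \in u :: rcons s v by rewrite in_cons mem_rcons mem_head orbT.
have v'B : v' \in v' :: rcons t' u' by exact: mem_head.
have u'B : u' \in v' :: rcons t' u' by rewrite in_cons mem_rcons mem_head orbT.
have sep h k : h \in u :: rcons s v -> k \in v' :: rcons t' u' -> (h == k) = false.
  by move=> hA kB; apply/eqP=> E; have := Ud h hA; rewrite E kB.
have i01 : induced_cycle ((u :: rcons s v) ++ v' :: rcons t' u') by rewrite /= cat_rcons.
have i02 : induced_cycle ((u :: rcons s v) ++ rev p).
  apply: (attached_arc att ip0 pb0) => h hA; first by rewrite cE hA.
    by rewrite (sep h u') ?orbF.
  by rewrite (sep h v') ?orbF.
have i12 : induced_cycle (rev (v' :: rcons t' u') ++ rev p).
  apply: (attached_arc att (induced_path_rev ip1) (path_between_rev pb1)) => h;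
    rewrite mem_rev => hB; first by rewrite cE hB orbT.
    by rewrite eq_sym (sep u h).
  by rewrite eq_sym (sep v h).
have [p' [pE lp Up pp]] := path_betweenP (att_ends att).
have ap : a \in p by rewrite pE mem_head.
have bp : b \in p by rewrite pE -lp mem_last.
have ua : u -- a by rewrite (att_edge att (att_u att) ap) !eqxx.
have u'a : u' -- a by rewrite (att_edge att (att_u' att) ap) !eqxx /= orbT.
have vb : v -- b by rewrite (att_edge att (att_v att) bp) !eqxx /= orbT.
have v'b : v' -- b by rewrite (att_edge att (att_v' att) bp) !eqxx /= !orbT.
have ab : a != b.
  case: p' pE lp Up {pp} => [|d r] pE lp Up; first by have := att_size att; rewrite pE.
  by apply: contraTneq Up => ab; rewrite /= {1}ab -lp /= mem_last.
have ne h k : h \in c -> k \in p -> h != k.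
  by move=> hc kp; apply: contraTneq hc => ->; exact: (att_out att).
pose L := tuple3 (u :: rcons s v) (rev (v' :: rcons t' u')) p.
exists (tuple3 u u' a), (tuple3 v v' b), L; split.
- have tri (d e f : G) : d -- e -> d -- f -> e -- f -> triangle (tuple3 d e f).
    move=> de df ef i j; move: i j; apply: forall_ord3_neq => [i j|]; first by rewrite sedgeC.
    exact: (@forall_ord3_lt (fun i j => tuple3 d e f i -- tuple3 d e f j)).
  split; [by apply: tri|by apply: tri|].
  have xy i j : tuple3 u u' a i != tuple3 v v' b j.
    have [n1 n2 n3 n4] := And4 (att_uv att) (att_uv' att) (att_u'v att) (att_u'v' att).
    move: i j; apply: forall_ord3; apply: forall_ord3; rewrite /tuple3 //=.
    + by apply: ne => //; exact: att_u att.
    + by apply: ne => //; exact: att_u' att.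
    + by rewrite eq_sym; apply: ne => //; exact: att_v att.
    by rewrite eq_sym; apply: ne => //; exact: att_v' att.
  apply/pred0P=> h; apply/negP=> /= /andP[/imsetP[i _ ->] /imsetP[j _ E]].
  by have := xy i j; rewrite E eqxx.
- apply: forall_ord3; [exact: pb0|exact: path_between_rev|exact: att_ends att].
- have dis q r : {in q, forall h, h \notin r} -> [disjoint path_vertices q & path_vertices r].
    move=> H; apply/pred0P=> h /=; apply/negP=> /andP[]; rewrite !inE => /H hr hr'.
    by rewrite hr' in hr.
  apply: (@forall_ord3_lt (fun i j => [disjoint path_vertices (L i) & path_vertices (L j)]));
    apply: dis; rewrite /L /tuple3 /= => h; rewrite ?mem_rev.
  + exact: Ud.
  + by move=> hA; apply/negP=> /(att_out att); rewrite cE hA.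
  by move=> hB; apply/negP=> /(att_out att); rewrite cE hB orbT.
apply: (@forall_ord3_lt (fun i j => induces_cycle (path_vertices (L i) :|: path_vertices (L j))));
  rewrite /L /tuple3 /=.
- by apply: (induces_cycle_union i01) => h; rewrite mem_cat mem_rev.
- by apply: (induces_cycle_union i02) => h; rewrite mem_cat mem_rev.
by apply: (induces_cycle_union i12) => h; rewrite mem_cat !mem_rev.
Qed.

End Attachment.

(** * Existence of a configuration *)

Section Shortest.
Variable G : sgraph.
Implicit Types (x y u v w z h : G) (p q s t : seq G) (L P : 'I_3 -> seq G).

Lemma shortest_seq (V : seq G -> bool) p : V p ->
  exists q, V q /\ forall r, V r -> size q <= size r.
Proof.
have [n] := ubnP (size p); elim: n p => // n IH p pn Vp.
case: (classic (exists r, V r /\ size r < size p)) => [[r [Vr rp]]|np].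
  by apply: (IH r) => //; apply: leq_trans rp _.
exists p; split=> // r Vr; rewrite leqNgt; apply/negP=> rp; apply: np; by exists r.
Qed.

(** Repeated vertices are allowed, as minimal length removes them. The default [x0] is harmless
    since the list is not empty. *)
Definition connecting (x0 : G) (D : pred G) (Q : rel G) p : bool :=
  [&& p != [::], sorted (@sedge G) p, all D p & Q (head x0 p) (last x0 p)].

Lemma shortest_connecting x0 D Q p : connecting x0 D Q p ->
  exists q, [/\ connecting x0 D Q q, induced_path q &
    forall i j, i <= j < size q -> Q (nth x0 q i) (nth x0 q j) ->
      i = 0 /\ j = (size q).-1].
Proof.
case/shortest_seq=> q [cq qmin]; exists q; have /and4P[q0 so aD qQ] := cq.
have so' := sortedP x0 so.
(* Removing the entries from [k] up to but excluding [l] keeps the list connecting if entry [k.-1]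
   is adjacent to entry [l] or, for [k = 0], if the head stays the same vertex. A repetition or a
   chord would allow such a removal. *)
have nomore k l : k < l -> l < size q ->
    (0 < k -> nth x0 q k.-1 -- nth x0 q l) -> (k = 0 -> nth x0 q l = nth x0 q 0) -> False.
  move=> kl lq kp k0.
  have sz : size (take k q ++ drop l q) = k + (size q - l).
    by rewrite size_cat size_drop size_takel //; slia.
  suff /qmin : connecting x0 D Q (take k q ++ drop l q) by rewrite sz; slia.
  apply/and4P; split.
  - by rewrite -size_eq0 sz; slia.
  - apply/(sortedP x0) => i; rewrite sz => iq; rewrite !nth_cat !size_takel; last slia.
    case: ltnP => i1; case: ltnP => i2; try slia.
    + by rewrite !nth_take //; apply: so'; slia.
    + rewrite nth_take // nth_drop (_ : l + _ = l); last slia.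
      by rewrite (_ : i = k.-1); [apply: kp|]; slia.
    by rewrite !nth_drop (_ : l + (i.+1 - k) = (l + (i - k)).+1); [apply: so'|]; slia.
  - rewrite all_cat; apply/andP; split; apply/allP=> u.
      by move/mem_take/(allP aD).
    by move/mem_drop/(allP aD).
  have dl : drop l q != [::] by rewrite -size_eq0 size_drop; slia.
  rewrite last_cat -[last _ (drop l q)](_ : last x0 (drop l q) = _); last first.
    by case: (drop l q) dl.
  rewrite -nth_last size_drop nth_drop (_ : l + _ = (size q).-1); last slia.
  rewrite nth_last -nth0 nth_cat size_takel; last slia.
  case: ltnP => k1; first by rewrite nth_take // nth0.
  by rewrite nth_drop (_ : l + (0 - k) = l) ?k0 ?nth0 //; slia.
split=> //.
  split=> [|x1 i j /andP[ij jq]].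
    apply/(uniqP x0) => i j; rewrite !inE => iq jq E.
    case: (ltngtP i j) => // ij; [case: (nomore i j ij jq)|case: (nomore j i ij iq)].
    + by move=> i_gt0; rewrite -E -{2}(prednK i_gt0); apply: so'; rewrite prednK.
    + by move=> i0; rewrite -E i0.
    + by move=> i_gt0; rewrite E -{2}(prednK i_gt0); apply: so'; rewrite prednK.
    by move=> i0; rewrite E i0.
  rewrite !(set_nth_default x0) //; last exact: ltn_trans jq.
  apply/idP/eqP=> [e|->]; last by apply: so'; slia.
  apply/eqP; apply: contraT => ne; case: (nomore i.+1 j) => //; slia.
(* The segment from [i] to [j] is itself connecting, so it cannot be shorter than [q]. *)
move=> i j /andP[ij jq] Qij.
have sz : size (take (j - i).+1 (drop i q)) = (j - i).+1.
  by rewrite size_takel // size_drop; slia.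
have : connecting x0 D Q (take (j - i).+1 (drop i q)).
  apply/and4P; split.
  - by rewrite -size_eq0 sz.
  - by apply: take_sorted; apply: drop_sorted.
  - by apply/allP=> u /mem_take/mem_drop/(allP aD).
  rewrite -nth0 -nth_last sz !nth_take ?nth_drop ?addn0 ?subnKC //.
by move/qmin; rewrite sz; slia.
Qed.

Lemma first_entry (H : pred G) x s : path (@sedge G) x s -> ~~ H x -> H (last x s) ->
  exists s' v, [/\ path (@sedge G) x s', all (predC H) (x :: s'),
    last x s' -- v, H v & v \in s].
Proof.
elim: s x => [|u s IH] x /=; first by move=> _ /negP.
case/andP=> xu pa nx lH; have [Hu|nu] := boolP (H u).
  by exists [::], u; rewrite /= nx mem_head; split.
have [s' [v [ps' as' e Hv vs]]] := IH u pa nu lH.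
exists (u :: s'), v; split; rewrite //= ?xu ?nx //=.
by rewrite in_cons vs orbT.
Qed.

End Shortest.

(** * From a bad theta to a hole with a path *)

Section Claw.
Variable G : sgraph.
Implicit Types (x y u v w z h k a b c d : G) (p q s t : seq G) (L P : 'I_3 -> seq G).

(* [C] is the component of [y] in the graph without the neighbours of [x]; each
   of the three paths leaves it, seen from [y], through a neighbour of [x]. *)
Lemma bad_theta_claw x y L : bad_theta x y L ->
  exists (C : {set G}) a b c,
    [/\ [/\ x -- a, x -- b & x -- c], [/\ a != b, a != c, b != c & ~~ (a -- b)],
        forall u, u \in C -> u != x /\ ~~ (x -- u),
        forall d, d \in [:: a; b; c] -> exists2 u, u \in C & d -- u &
        forall u v, u \in C -> v \in C ->
          exists s, [/\ path (@sedge G) u s, last u s = v & {subset u :: s <= C}]].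
Proof.
case=> ct nt; have [xy nxy pb _] := ct.
pose far u := (u != x) && ~~ (x -- u).
pose e := [rel u v | [&& u -- v, far u & far v]].
pose C := [set u | connect e y u].
have yfar : far y by rewrite /far eq_sym xy.
have yC : y \in C by rewrite inE connect0.
have e_sym : connect_sym e.
  by apply: sym_connect_sym => u v /=; rewrite sedgeC [far u && _]andbC.
have Cfar u : u \in C -> far u.
  rewrite inE => /connectP[s + ->]; case/lastP: s => // s v.
  by rewrite rcons_path last_rcons => /andP[_ /and3P[]].
have Cstep u v : u \in C -> u -- v -> far v -> v \in C.
  move=> uC uv fv; have fu := Cfar u uC; move: uC; rewrite !inE => yu.
  by apply: connect_trans yu _; apply: connect1; rewrite /= uv fu.
have xC : x \notin C by apply/negP=> /Cfar; rewrite /far eqxx.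
have leave i : exists k, [&& x -- k, k \in path_interior x y (L i) & [exists u in C, k -- u]].
  have [s [Ls ls U pa]] := path_betweenP (pb i).
  have sep : (x \in C) != (last x s \in C) by rewrite ls yC (negbTE xC).
  have [u [k [uC kC uk _ ks]]] := path_crossing pa sep.
  have kx : k != x.
    by apply: contraTneq uk => ->; have /andP[_] := Cfar u uC; rewrite sedgeC.
  (* A vertex adjacent to [C] that is neither [x] nor a neighbour of [x] would belong to [C]. *)
  have xk : x -- k.
    by apply: contraNT kC => nxk; apply: (Cstep u) => //; rewrite /far kx.
  exists k; rewrite xk in_interior kx Ls ks andbT /=; apply/andP; split.
    by apply: contraNneq kC => ->.
  by apply/existsP; exists u; rewrite uC sedgeC.
pose k i := xchoose (leave i).
have kP i : [&& x -- k i, k i \in path_interior x y (L i) & [exists u in C, k i -- u]].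
  exact: (xchooseP (leave i)).
have kne i j : i != j -> k i != k j.
  move=> ij; apply/eqP=> E; have /and3P[_ + _] := kP i; have /and3P[_ + _] := kP j.
  rewrite -E !in_interior => /and3P[_ _ kj] /and3P[/eqP nx /eqP ny ki].
  by case: (chorded_theta_disj ct ij ki kj).
(* Were the three chosen neighbours of [x] pairwise adjacent, they would form a transversal. *)
have [i [j [ij nij]]] : exists i j, i != j /\ ~~ (k i -- k j).
  apply: NNPP => nn; apply: nt; exists k => [i j ij|i]; last by case/and3P: (kP i).
  by apply/negPn/negP=> h; apply: nn; exists i, j.
have [l /andP[li lj]] := third_ord3 i j.
exists C, (k i), (k j), (k l); split.
- by split; have /and3P[] := kP i; have /and3P[] := kP j; have /and3P[] := kP l.
- by split=> //; apply: kne; rewrite // eq_sym.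
- by move=> u /Cfar/andP[].
- move=> d; rewrite !inE => dk; have [m ->] : exists m, d = k m.
    by case/or3P: dk => /eqP->; [exists i|exists j|exists l].
  by have /and3P[_ _ /existsP[u /andP[uC du]]] := kP m; exists u.
move=> u v uC vC; have : connect e u v.
  by move: uC vC; rewrite !inE e_sym; exact: connect_trans.
case/connectP=> s pe ->; exists s; split=> //.
  by apply: sub_path pe => ? ? /and3P[].
elim: s u uC pe {vC} => [|d s IH] u uC /=; first by move=> _ h; rewrite inE => /eqP->.
case/andP=> /and3P[ud _ fd] pe h; rewrite in_cons => /orP[/eqP->//|].
by apply: (IH d) => //; apply: Cstep ud fd.
Qed.

(* The rim goes through [x], [a], [C] and [b]; the path starts at [c] and runs
   through [C]. *)
Lemma bad_theta_hole x y L : bad_theta x y L ->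
  exists (r p : seq G), [/\ induced_cycle r, induced_path p, p != [::],
    {in p, forall h, h \notin r} /\
    exists u v, [/\ u \in r /\ v \in r, u != v, ~~ (u -- v), u -- head x p & v -- last x p] &
    forall i j u v, i <= j < size p -> u \in r -> v \in r ->
      u -- nth x p i -> v -- nth x p j -> (0 < i) || (j < (size p).-1) ->
      u = v \/ u -- v].
Proof.
case/bad_theta_claw=> C [a [b [c [[xa xb xc] [ab ac bc nab] far nbr conn]]]].
have notC d : x -- d -> d \notin C.
  by move=> xd; apply/negP=> /far[_]; rewrite xd.
have xNC : x \notin C by apply/negP=> /far[]; rewrite eqxx.
have [u uC au] := nbr a (mem_head _ _).
have [v vC bv] : exists2 v, v \in C & b -- v by apply: nbr; rewrite !inE eqxx orbT.
have [w wC cw] : exists2 w, w \in C & c -- w by apply: nbr; rewrite !inE eqxx !orbT.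
(* A shortest path from [a] to [b] through [C] will close up with [x] to the rim. *)
pose D1 : pred G := [pred h | [|| h == a, h == b | h \in C]].
pose Q1 : rel G := [rel h k | (h == a) && (k == b)].
have : exists q, connecting x D1 Q1 q.
  have [s [ps ls sC]] := conn u v uC vC.
  exists (a :: u :: rcons s b); apply/and4P; split=> //.
  - by rewrite /= au rcons_path ps ls sedgeC.
  - apply/allP=> h; rewrite !(in_cons, mem_rcons) /D1 /= => /or4P[->|/eqP->|->|hs].
    + by [].
    + by rewrite uC !orbT.
    + by rewrite orbT.
    by rewrite sC ?orbT // in_cons hs orbT.
  by rewrite /Q1 /= last_rcons !eqxx.
case=> q0 /shortest_connecting[q [/and4P[qn so qD /andP[/eqP hq /eqP lq]] iq _]].
have inD h : h \in q -> [|| h == a, h == b | h \in C] by move/(allP qD).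
have xq : x \notin q.
  apply/negP=> /inD/or3P[/eqP E|/eqP E|]; last exact/negP.
    by rewrite -E sedge_irr in xa.
  by rewrite -E sedge_irr in xb.
have q2 : 1 < size q.
  case: q hq lq {so qD iq inD xq} qn => [|d [|d' q]] //= -> E _.
  by rewrite E eqxx in ab.
have aq : a \in q by rewrite -hq; case: q qn {hq lq so qD iq inD xq q2} => // *; exact: mem_head.
have bq : b \in q by rewrite -lq; case: q qn {hq lq so qD iq inD xq q2 aq} => //= *; exact: mem_last.
have ir : induced_cycle (q ++ rev [:: x]).
  apply: (cat_rev_induced_cycle (x0 := x)) => //.
  - by split=> // x0 i j /=; rewrite ltnS leqn0 => /andP[+ /eqP j0]; rewrite j0.
  - by rewrite addn1.
  - by move=> h hq'; rewrite inE; apply: contraNneq xq => <-.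
  move=> h k hq'; rewrite inE => /eqP->; rewrite hq lq /= eqxx !andbT sedgeC.
  case/or3P: (inD h hq') => [/eqP->|/eqP->|hC]; rewrite ?eqxx ?orbT //.
  have [_ /negbTE ->] := far h hC.
  by apply/esym/negbTE; rewrite negb_or; apply/andP; split; apply: contraTneq hC => ->; apply: notC.
set r := q ++ rev [:: x] in ir.
have rE h : (h \in r) = (h \in q) || (h == x) by rewrite mem_cat inE.
(* As [a] and [b] are not adjacent, the path between them has an inner vertex, which lies in [C]; it
   is the target on the rim for a path from [c]. *)
have [h0 h0q h0C] : exists2 h, h \in q & h \in C.
  apply: NNPP => nn; have U : uniq q by case: iq.
  have sub : {subset q <= [:: a; b]}.
    move=> h hq'; rewrite !inE; case/or3P: (inD h hq') => [->|->|hC]; rewrite ?orbT //.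
    by case: nn; exists h.
  have sz := uniq_leq_size U sub.
  case: q hq lq q2 sz so nab {ir r rE nn inD qn qD iq xq aq bq U sub} => [|d [|d' [|d'' q]]] //=.
  by move=> -> -> _ _; rewrite andbT => ->.
have cq : c \notin q.
  apply/negP=> /inD; rewrite !(eq_sym c) (negbTE ac) (negbTE bc) /=; by apply/negP; exact: notC.
have cr : c \notin r.
  by rewrite rE negb_or cq; apply: contraTneq xc => ->; rewrite sedge_irr.
pose D2 : pred G := [pred h | h \notin r].
pose Q2 : rel G := [rel s t | [exists u in r, exists v in r,
   [&& u != v, ~~ (u -- v), u -- s & v -- t]]].
have Q2P (s t : G) : reflect (exists u v, [/\ u \in r /\ v \in r, u != v, ~~ (u -- v), u -- s & v -- t])
    (Q2 s t).
  apply: (iffP existsP) => [[g /andP[gr /existsP[h /andP[hr /and4P[]]]]]|].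
    by exists g, h.
  case=> g [h [[gr hr] n1 n2 e1 e2]]; exists g; rewrite gr; apply/existsP; exists h.
  by rewrite hr n1 n2 e1 e2.
have : exists p, connecting x D2 Q2 p.
  (* From [c] walk through [C] towards [h0] and stop before the first rim vertex [d]. Then [x] is
     attached to the start and [d] to the end, and [d], lying in [C], is not adjacent to [x]. *)
  have [s [ps ls sC]] := conn w h0 wC h0C.
  have pc : path (@sedge G) c (w :: s) by rewrite /= cw.
  have [|s' [d [ps' as' ed dr ds]]] := first_entry (H := mem r) pc cr.
    by rewrite /= ls rE h0q.
  exists (c :: s'); apply/and4P; split=> //.
  apply/Q2P; exists x, d; have [dx nxd] := far d (sC d ds); split=> //.
  - by rewrite rE eqxx orbT.
  - by rewrite eq_sym.
  by rewrite sedgeC.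
case=> p0 /shortest_connecting[p [/and4P[pn _ pD /Q2P pQ] ip pmin]].
exists r, p; split=> //; first by split=> // h /(allP pD).
move=> i j g h ij gr hr e1 e2 ends; apply: NNPP => nn.
have [|E1 E2] := pmin i j ij; last by move: ends; rewrite E1 E2 !ltnn.
apply/Q2P; exists g, h; split=> //.
  by apply/eqP=> E; apply: nn; left.
by apply/negP=> E; apply: nn; right.
Qed.

End Claw.

(** * Cases for the attachments of the path *)

Section Existence.
Variable G : sgraph.
Implicit Types (x y u v w z h g : G) (p q r s t : seq G) (L P : 'I_3 -> seq G).

Lemma induced_path_sorted p : induced_path p -> sorted (@sedge G) p.
Proof.
case=> U E; case: p U E => // a p U E; apply/(sortedP a) => i ip.
by rewrite E ?eqxx // ltnSn.
Qed.

(** When the cycle is listed from [w], the two neighbours of [w] are the ends of the remaining list,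
    which is reversed if it starts with [v]. *)
Lemma rotate_to_center r u v w : induced_cycle r -> u \in r -> v \in r -> w \in r ->
  w -- u -> w -- v -> u != v ->
  exists t, [/\ induced_cycle (w :: t), w :: t =i r, path_between u v t & induced_path t].
Proof.
move=> ir ur vr wr wu wv uv.
have good t : induced_cycle (w :: t) -> w :: t =i r -> head w t = u -> last w t = v ->
    [/\ induced_cycle (w :: t), w :: t =i r, path_between u v t & induced_path t].
  move=> it tE ht lt; have ip : induced_path t by apply: (@induced_cycle_suffix _ [:: w]).
  split=> //; rewrite /path_between (induced_path_sorted ip) (proj1 ip).
  by case: t ht lt {it tE ip} => [|d t] /= ht lt; [rewrite -ht -lt eqxx in uv|rewrite lt ht !eqxx].
have [t [it tE]] := rotate_to_vertex ir wr.
have t0 : t != [::] by have [+ _ _] := it; case: (t).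
have nbr d : d \in r -> w -- d -> d = head w t \/ d = last w t.
  rewrite -tE => /(nthP w)[i ilt E] wd; have c0 : 0 < size (w :: t) by [].
  have := induced_cycle_nth w it c0 ilt; rewrite E /= wd => /esym.
  have i0 : i != 0 by apply: contraTneq wd => i0; rewrite -E i0 sedge_irr.
  move=> H; have [i1|i1] : i = 1 \/ i = size t by slia.
    by left; rewrite -E i1 /= nth0.
  right; rewrite -E i1 -[last w t]/(last w (w :: t)); exact: (nth_last w (w :: t)).
have it' : induced_cycle (w :: rev t).
  by apply/(induced_cycle_rot 1); rewrite rot1_cons -rev_cons; apply/induced_cycle_rev.
have tE' : w :: rev t =i r by move=> h; rewrite -tE !in_cons mem_rev.
case: (nbr u ur wu) (nbr v vr wv) => [uh|uh] [vh|vh].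
- by rewrite uh vh eqxx in uv.
- by exists t; apply: good.
- exists (rev t); apply: good => //; rewrite ?uh ?vh.
    by case/lastP: (t) t0 => // s d _; rewrite rev_rcons last_rcons.
  by case: (t) t0 => // d s _; rewrite rev_cons last_rcons.
by rewrite uh vh eqxx in uv.
Qed.

(** The neighbours of [k] on [r] are pairwise adjacent, and an induced cycle of length at least four
    contains no triangle; so there are at most two. *)
Lemma clique_attachment r k u : induced_cycle r -> 4 <= size r ->
  (forall g h, g \in r -> h \in r -> g -- k -> h -- k -> g = h \/ g -- h) ->
  u \in r -> u -- k ->
  exists u', [/\ u' \in r, u = u' \/ u -- u' &
    {in r, forall h, h -- k = (h == u) || (h == u')}].
Proof.
move=> ir r4 cl ur uk.
case: (classic (exists u', [/\ u' \in r, u' != u & u' -- k])) => [[u' [u'r u'u u'k]]|nn].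
  have uu' : u -- u' by case: (cl u u' ur u'r uk u'k) => // E; rewrite E eqxx in u'u.
  exists u'; split=> //; first by right.
  move=> h hr; apply/idP/orP=> [hk|[/eqP->|/eqP->] //].
  case: (cl h u hr ur hk uk) => [->|hu]; first by left.
  case: (cl h u' hr u'r hk u'k) => [->|hu']; first by right.
  by case: (induced_cycle_triangle_free ir r4 hr ur u'r hu uu' hu').
exists u; split=> //; first by left.
move=> h hr; rewrite orbb; apply/idP/eqP=> [hk|-> //].
by apply/eqP; apply: contraT => hu; case: nn; exists h.
Qed.

Lemma bad_theta_configuration x y L : bad_theta x y L -> has_configuration G.
Proof.
case/bad_theta_hole=> r [p [ir ip p0 [pr [u [v [[ur vr] uv nuv uk vk]]]] F]].
have r4 := induced_cycle_size_ge4 ir ur vr uv nuv.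
rewrite -nth0 -nth_last in uk vk.
have n_gt0 : 0 < size p by rewrite lt0n size_eq0.
(* A single vertex attached to [u] and [v] is the center of a wheel with rim [r]. *)
have [n1|n_ne1] := eqVneq (size p) 1.
  constructor 1; exists (nth x p 0), r, u, v; rewrite n1 /= in vk.
  by split=> //; [apply: pr; apply: mem_nth|split; rewrite sedgeC].
have n_gt1 : 1 < size p by slia.
pose n := (size p).-1; rewrite -/n in vk F.
have n0 : 0 < n by rewrite /n; slia.
have np : n < size p by rewrite /n; slia.
have F' i j g h : i < size p -> j < size p -> g \in r -> h \in r ->
    g -- nth x p i -> h -- nth x p j -> ~~ ((i == 0) && (j == n)) -> ~~ ((j == 0) && (i == n)) ->
    g = h \/ g -- h.
  move=> ilt jlt gr hr gi hj e1 e2; case: (leqP i j) => ij.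
    by apply: (F i j); rewrite ?ij // /n in e1 e2 *; slia.
  case: (F j i h g) => //; rewrite /n in e1 e2 *; try slia; first by left.
  by right; rewrite sedgeC.
have [U pE] := ip.
have pinj i j : i < size p -> j < size p -> (nth x p i == nth x p j) = (i == j).
  by move=> ilt jlt; rewrite nth_uniq.
(* First case: some [w] on [r] is attached to a vertex of [p] other than the last and to one other
   than the first, possibly the same. It becomes the center of a wheel. *)
case: (classic (exists w i j, [/\ w \in r, i < n, 0 < j < size p, w -- nth x p i & w -- nth x p j])).
  case=> w [i [j [wr ilt /andP[j0 jlt] wi wj]]].
  (* Any attachment at [m] can be compared with that of [w] at [i] or at [j]. In particular [u] and
     [v] will be the two neighbours of [w] on [r]. *)
  have toW m h : m < size p -> h \in r -> h -- nth x p m -> h = w \/ h -- w.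
    move=> mlt hr hm; case: (ltnP m n) => mn.
      by apply: (F' m i) => //; rewrite /n in mn ilt *; slia.
    by apply: (F' m j) => //; rewrite /n in mn n0 *; slia.
  have wu : w -- u.
    rewrite sedgeC; case: (toW 0 u n_gt0 ur uk) => // uw.
    by case: (toW n v np vr vk); rewrite -uw ?(sedgeC v) => E; [rewrite E eqxx in uv|rewrite E in nuv].
  have wv : w -- v.
    rewrite sedgeC; case: (toW n v np vr vk) => // vw.
    by rewrite vw sedgeC wu in nuv.
  have [t [it tE tp ti]] := rotate_to_center ir ur vr wr wu wv uv.
  have wt : w \notin t by have [_ /=/andP[]] := it.
  have tr h : h \in t -> h \in r by rewrite -tE in_cons => ->; rewrite orbT.
  have [s [ts ls _ _]] := path_betweenP tp.
  (* Another attached vertex [h] of the arc [t] would form a triangle in [r] with [w] and one of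
     [u], [v]. So [t] and [p] are joined only at their ends. *)
  have near m h : m < size p -> h \in t -> h -- nth x p m ->
      (m < n -> h = u) /\ (0 < m -> h = v).
    move=> mlt ht hm; have hr := tr h ht.
    have hw : h -- w by case: (toW m h mlt hr hm) => // E; rewrite E (negbTE wt) in ht.
    split=> [mn|m_gt0].
      have : u = h \/ u -- h by apply: (F' 0 m) => //; rewrite /n in mn *; slia.
      by case=> // uh; case: (induced_cycle_triangle_free ir r4 ur hr wr uh hw); rewrite sedgeC.
    have : h = v \/ h -- v by apply: (F' m n) => //; slia.
    by case=> // hv; case: (induced_cycle_triangle_free ir r4 hr vr wr hv); rewrite // sedgeC.
  constructor 1; exists w, (t ++ rev p), u, v; split=> //.
  - apply: (cat_rev_induced_cycle (x0 := x)) => //; first by rewrite ts.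
    + by rewrite ts /=; slia.
    + by move=> h /tr hr; apply/negP=> /pr; rewrite hr.
    move=> h k ht /(nthP x)[m mlt <-]; rewrite ts /= ls -nth0 -nth_last -/n !pinj //.
    apply/idP/orP=> [hm|[]/andP[/eqP-> /eqP->] //].
    have [hu hv] := near m h mlt ht hm; have [m0|m0] := eqVneq m 0.
      by left; rewrite hu ?eqxx // m0.
    have [mn|mn] := eqVneq m n; first by right; rewrite hv ?eqxx // lt0n.
    have E : u = v by rewrite -hu ?hv // ?lt0n //; rewrite /n in mn *; slia.
    by rewrite E eqxx in uv.
  - by rewrite mem_cat mem_rev negb_or wt; apply/negP=> /pr; rewrite wr.
  by split; rewrite mem_cat ts ?mem_head // -ls mem_last.
(* Second case: only the two ends of [p] are attached to [r], and no vertex of [r] is attached to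
   both. *)
move=> nW.
have only m h : m < size p -> h \in r -> h -- nth x p m -> m = 0 \/ m = n.
  move=> mlt hr hm; have [|m0] := eqVneq m 0; first by left.
  have [|mn] := eqVneq m n; first by right.
  case: nW; exists h, m, m; split=> //; rewrite /n in mn *; slia.
have notboth h : h \in r -> h -- nth x p 0 -> h -- nth x p n -> False.
  by move=> hr h0 hn; apply: nW; exists h, 0, n; split=> //; rewrite n0.
have [|u' [u'r uu' uE]] := @clique_attachment r (nth x p 0) u ir r4 _ ur uk.
  by move=> g h gr hr g0 h0; apply: (F' 0 0) => //; rewrite eqxx /=; slia.
have [|v' [v'r vv' vE]] := @clique_attachment r (nth x p n) v ir r4 _ vr vk.
  by move=> g h gr hr gn hn; apply: (F' n n) => //; slia.
have sepA g h : g \in r -> h \in r -> g -- nth x p 0 -> h -- nth x p n -> g != h.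
  by move=> gr hr g0 hn; apply/eqP=> E; rewrite E in g0; exact: (notboth h).
have u'0 : u' -- nth x p 0 by rewrite uE // eqxx orbT.
have v'n : v' -- nth x p n by rewrite vE // eqxx orbT.
have att : attached r p (nth x p 0) (nth x p n) u u' v v'.
  split=> //; try exact: sepA.
  - rewrite /path_between U induced_path_sorted // /n nth_last.
    by case: (p) p0 => //= d q _; rewrite !eqxx.
  move=> h k hr /(nthP x)[m mlt <-]; rewrite !pinj // -uE // -vE //.
  have [->|m0] := eqVneq m 0.
    by rewrite (ltn_eqF n0) orbF.
  have [->//|mn] := eqVneq m n.
  by apply/negP=> /(only m h mlt hr)[E|E]; rewrite E eqxx in m0 mn.
(* Each end is attached to one vertex or to one edge; for a pyramid, [p] is reversed if the edge is
   at its far end. *)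
case: uu' vv' => [uu'|uu'] [vv'|vv'].
- by rewrite -uu' -vv' in att; constructor 4; apply: theta_config att nuv.
- constructor 3; rewrite -uu' in att; apply: pyramid_config (attached_rev att) vv' _.
  by rewrite sedgeC.
- by constructor 3; rewrite -vv' in att; apply: pyramid_config att uu' nuv.
by constructor 2; apply: prism_config att uu' vv'.
Qed.

End Existence.

(** * The characterization *)

Lemma rungs_covers (G : sgraph) (x y : 'I_3 -> G) L j k : rungs x y L -> j != k ->
  ~~ (x j -- y k) ->
  (forall (x y : G) L, bad_theta x y L -> forall v, exists i, v \in L i) ->
  forall v, exists i, v \in L i.
Proof.
move=> R jk nadj cov v; have [a [b [M [bM sub]]]] := rungs_bad R jk nadj.
by have [i /sub] := cov a b M bM v.
Qed.

Lemma rungs_minimal (G : sgraph) (x y : 'I_3 -> G) L j k : rungs x y L -> j != k ->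
  ~~ (x j -- y k) -> (forall v, exists i, v \in L i) -> minimal_forbidden theta_ring G.
Proof.
move=> R jk nadj cov; apply/minimal_forbiddenP; split.
  by have [a [b [M [bM _]]]] := rungs_bad R jk nadj; exists a, b, M.
by move=> a b M [ct _]; exact: (rungs_cover R cov ct).
Qed.

Theorem corollary4p12 (T : sgraph) :
  minimal_forbidden theta_ring T <->
  theta_partial_wheel T \/ (prism T \/ pyramid T \/ theta T).
Proof.
split.
  case/minimal_forbiddenP=> -[x [y [L bL]]] cov.
  case: (bad_theta_configuration bL).
  - case=> z [r [u [v W]]]; left; exists z, r.
    (* By minimality the bad theta inside the wheel covers all vertices, so the wheel does;
       [rungs_covers] does the same for the other configurations. *)
    have [a [b [M [bM sub]]]] := wheel_bad W.
    case: W => ir zr [ur vr] [zu zv] [uv nuv]; split.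
    + by split=> // w; have [i /sub] := cov a b M bM w.
    + exact: induced_cycle_size_ge4 ir ur vr uv nuv.
    by exists u, v; rewrite uv.
  - case=> a [b [M pM]]; have [R nadj] := prism_rungs pM.
    right; left; exists a, b, M; case: pM => ? ? ? ?; split=> //.
    exact: rungs_covers R _ nadj cov.
  - case=> w [z [P pP]]; have [R [k nadj]] := pyramid_rungs pP.
    (* All tops are [w], so any index [j] other than [k] will do. *)
    have [j /andP[jk _]] := third_ord3 k k.
    right; right; left; exists w, z, P; case: pP => ? ? ? ?; split=> //.
    exact: (rungs_covers R jk nadj cov).
  case=> a [b [P tP]]; have [R nadj] := theta_rungs tP.
  right; right; right; exists a, b, P; case: tP => ? ? ? ?; split=> //.
  by apply: (rungs_covers R (_ : i0 != i1) nadj cov).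
case=> [[z [r [pw _ [u [v [ur vr zu zv /andP[uv nuv]]]]]]]|[|[]]].
- have [ir zr _] := pw; apply/minimal_forbiddenP; split.
    have W : wheel_on z r u v by [].
    by have [a [b [M [bM _]]]] := wheel_bad W; exists a, b, M.
  by move=> a b M [ct _]; exact: (wheel_cover pw ct).
- case=> a [b [M [? ? ? ? cov]]]; have [//|R nadj] := @prism_rungs _ a b M.
  exact: rungs_minimal R _ nadj cov.
- case=> w [z [P [? ? ? ? cov]]]; have [//|R [k nadj]] := @pyramid_rungs _ w z P.
  have [j /andP[jk _]] := third_ord3 k k.
  exact: (rungs_minimal R jk nadj cov).
case=> a [b [P [? ? ? ? cov]]]; have [//|R nadj] := @theta_rungs _ a b P.
by apply: (rungs_minimal R (_ : i0 != i1) nadj cov).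
Qed.
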